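(* Let $D\in\mathbb{N}$ and let $T:\mathbb{T}^D\times[0,1]\to\mathbb{T}^D\times[0,1]$ belong to the class $\mathcal{T}^*$. Then the Hausdorff dimension of the upper bounding graph of $T$, i.e. of the point set $\Phi^+=\{(\theta,\varphi^+(\theta))\mid\theta\in\mathbb{T}^D\}$, is $D$.
   Context: Notation: $\mathbb{N}=\{1,2,\dots\}$; $\mathbb{T}^D=\mathbb{R}^D/\mathbb{Z}^D$ with the metric $\mathrm{dist}$ induced by the Euclidean metric; $\mathbb{T}^D\times[0,1]$ carries the usual product metric. Class $\mathcal{T}$: maps $T(\theta,x)=(\omega(\theta),T_\theta(x))$ on $\mathbb{T}^D\times[0,1]$, where $\omega(\theta)=\theta+\rho\bmod 1$ is an irrational rotation ($\rho\in\mathbb{R}^D\setminus\mathbb{Q}^D$) and the fibre maps $T_\theta:[0,1]\to[0,1]$ satisfy: (1) each $T_\theta$ is monotonically increasing (in the weak sense, i.e. non-decreasing); (2) each $T_\theta$ is differentiable and $(\theta,x)\mapsto T_\theta'(x)$ is continuous; (3) $T$ is pinched: there is $\theta_*\in\mathbb{T}^D$ such that $T_{\theta_*}([0,1])$ is a single point; (4) $T_\theta(0)=0$ for all $\theta$. Class $\mathcal{T}^*$: with $\tau_n=\omega^n(\theta_* )$, those $T\in\mathcal{T}$ for which there exist constants $\alpha>2$, $\gamma>0$, $L_0\in(0,1)$, $\beta>0$, $c>0$, $d>1$, $m\in\mathbb{N}$, $a>1$, $0<b<1$ such that (i) $|T_\theta(x)-T_\theta(y)|\leq\alpha|x-y|$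 for all $\theta$ and $x,y\in[0,1]$; (ii) $|T_\theta(x)-T_\theta(y)|\leq\alpha^{-\gamma}|x-y|$ for all $\theta$ and $x,y\in[L_0,1]$; (iii) $|T_\theta(x)-T_{\theta'}(x)|\leq\beta\,\mathrm{dist}(\theta,\theta')$ for all $\theta,\theta'$ and $x\in[0,1]$; (iv) $\mathrm{dist}(\tau_n,\theta_* )\geq c\,n^{-d}$ for all $n\in\mathbb{N}$; (v) $m>22(1+1/\gamma)$, $a\geq(m+1)^d$, $b\leq c$, and $\mathrm{dist}(\tau_n,\theta_* )>b$ for all $n\in\{1,\dots,m-1\}$; (vi) $T_\theta(x)\geq\min\{L_0,ax\}\cdot\min\{1,\tfrac{2}{b}\mathrm{dist}(\theta,\theta_* )\}$ for all $(\theta,x)\in\mathbb{T}^D\times[0,1]$. Upper bounding graph: $\varphi^+(\theta)=\sup\{x\in[0,1]\mid(\theta,x)\in\mathcal{A}\}$ with $\mathcal{A}=\bigcap_{n\in\mathbb{N}}T^n(\mathbb{T}^D\times[0,1])$. The Hausdorff dimension of a set $A$ is $D_H(A)=\sup\{s\geq0\mid\mathcal{H}^s(A)=\infty\}$, with $\mathcal{H}^s$ the $s$-dimensional Hausdorff measure. *)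

(* Defs.v *)
From HB Require Import structures.
From mathcomp Require Import all_boot all_order all_algebra.
From mathcomp Require Import all_classical all_reals all_analysis.
From mathcomp Require Import generic_quotient ring_quotient.
From mathcomp Require Import ring lra.

Set Implicit Arguments.
Unset Strict Implicit.
Unset Printing Implicit Defensive.

Import Order.TTheory GRing.Theory Num.Theory.
Import numFieldNormedType.Exports.

Local Open Scope classical_set_scope.
Local Open Scope ring_scope.
Local Open Scope quotient_scope.

(* The matrix norm of MathComp-Analysis is the sup norm, so the Euclidean norm
   on R^D is introduced here. *)
Definition eucl_norm (R : realType) (D : nat) (u : 'rV[R]_D) : R :=
  Num.sqrt (\sum_(i < D) u 0 i ^+ 2).

Section EuclideanNorm.
Context (R : realType) (D : nat).
Implicit Types u v : 'rV[R]_D.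

Lemma eucl_norm_ge0 u : 0 <= eucl_norm u.
Proof. exact: sqrtr_ge0. Qed.

Lemma eucl_norm0 : eucl_norm (0 : 'rV[R]_D) = 0.
Proof.
by rewrite /eucl_norm big1 ?sqrtr0// => i _; rewrite mxE expr0n.
Qed.

Lemma eucl_normN u : eucl_norm (- u) = eucl_norm u.
Proof.
by congr Num.sqrt; apply: eq_bigr => i _; rewrite mxE sqrrN.
Qed.

Lemma sum_sqr_ge0 u : 0 <= \sum_(i < D) u 0 i ^+ 2.
Proof. by apply: sumr_ge0 => i _; exact: sqr_ge0. Qed.

Lemma eucl_norm_coord u i : `|u 0 i| <= eucl_norm u.
Proof.
rewrite -sqrtr_sqr ler_wsqrtr// (bigD1 i)//= lerDl.
by apply: sumr_ge0 => j _; exact: sqr_ge0.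
Qed.

Lemma sum_Cauchy_Schwarz u v :
  (\sum_(i < D) u 0 i * v 0 i) ^+ 2 <=
  (\sum_(i < D) u 0 i ^+ 2) * (\sum_(i < D) v 0 i ^+ 2).
Proof.
have E : \sum_(i < D) \sum_(j < D) (u 0 i * v 0 j - u 0 j * v 0 i) ^+ 2 =
    ((\sum_(i < D) u 0 i ^+ 2) * (\sum_(i < D) v 0 i ^+ 2)
     - (\sum_(i < D) u 0 i * v 0 i) ^+ 2) *+ 2.
  set A := \sum_(i < D) u 0 i ^+ 2; set B := \sum_(i < D) v 0 i ^+ 2.
  rewrite (_ : _ *+ 2 = A * B + B * A -
    ((\sum_(i < D) u 0 i * v 0 i) * (\sum_(i < D) u 0 i * v 0 i)) *+ 2);
    last by ring.
  rewrite !big_distrlr/= -sumrMnl -big_split/= -sumrB; apply: eq_bigr => i _.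
  by rewrite -sumrMnl -big_split/= -sumrB; apply: eq_bigr => j _; ring.
rewrite -subr_ge0 -(@pmulrn_lge0 _ _ 2)// -E.
by apply: sumr_ge0 => i _; apply: sumr_ge0 => j _; exact: sqr_ge0.
Qed.

Lemma eucl_normD u v : eucl_norm (u + v) <= eucl_norm u + eucl_norm v.
Proof.
rewrite -(@ler_pXn2r _ 2)// ?nnegrE ?addr_ge0 ?eucl_norm_ge0//.
rewrite sqrrD !sqr_sqrtr ?sum_sqr_ge0//.
have -> : \sum_(i < D) (u + v) 0 i ^+ 2 = \sum_(i < D) u 0 i ^+ 2
    + (\sum_(i < D) u 0 i * v 0 i) *+ 2 + \sum_(i < D) v 0 i ^+ 2.
  rewrite -sumrMnl -!big_split/=; apply: eq_bigr => i _.
  by rewrite mxE sqrrD.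
rewrite lerD2r lerD2l lerMn2r/= (le_trans (ler_norm _))//.
rewrite -sqrtr_sqr -sqrtrM ?sum_sqr_ge0//.
by rewrite ler_wsqrtr// sum_Cauchy_Schwarz.
Qed.

End EuclideanNorm.

(* Z^D *)
Definition int_lattice (R : realType) (D : nat) : pred 'rV[R]_D :=
  fun u => u \is a mxOver (Num.int : {pred R}).

Lemma int_lattice_zmod_closed (R : realType) (D : nat) :
  zmod_closed (@int_lattice R D).
Proof.
split; first by apply/mxOverP => i j; rewrite mxE; exact: rpred0.
move=> u v /mxOverP uZ /mxOverP vZ.
by apply/mxOverP => i j; rewrite !mxE; exact: rpredB.
Qed.

HB.instance Definition _ (R : realType) (D : nat) :=
  GRing.isZmodClosed.Build _ (@int_lattice R D) (@int_lattice_zmod_closed R D).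

(* T^D = R^D / Z^D, with its group structure. *)
Definition torus (R : realType) (D : nat) : Type :=
  Quotient.quot (GRing.ZmodClosed.clone _ (@int_lattice R D) _).

HB.instance Definition _ (R : realType) (D : nat) :=
  GRing.Zmodule.on (torus R D).
HB.instance Definition _ (R : realType) (D : nat) :=
  EqQuotient.on (torus R D).
HB.instance Definition _ (R : realType) (D : nat) :=
  ZmodQuotient.on (torus R D).

Definition torus_dist (R : realType) (D : nat) (x y : torus R D) : R :=
  inf [set r | exists u v : 'rV[R]_D,
         [/\ \pi_(torus R D) u = x, \pi_(torus R D) v = y
           & r = eucl_norm (u - v)]].

Section TorusDist.
Context (R : realType) (D : nat).
Implicit Types (x y z : torus R D) (u v w : 'rV[R]_D).

Local Notation dist_set x y := [set r | exists u v : 'rV[R]_D,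
         [/\ \pi_(torus R D) u = x, \pi_(torus R D) v = y
           & r = eucl_norm (u - v)]].

Lemma torus_pi_eq u v :
  (\pi_(torus R D) u == \pi_(torus R D) v) =
  (u - v \is a mxOver (Num.int : {pred R})).
Proof. by rewrite -Quotient.idealrBE. Qed.

Lemma has_inf_dist_set x y : has_inf (dist_set x y).
Proof.
split; first by exists (eucl_norm (repr x - repr y)), (repr x), (repr y);
  rewrite !reprK.
by exists 0 => _ [u [v [_ _ ->]]]; exact: eucl_norm_ge0.
Qed.

Lemma torus_dist_le u v :
  torus_dist (\pi_(torus R D) u) (\pi_(torus R D) v) <= eucl_norm (u - v).
Proof. by apply: ge_inf; [exact: (has_inf_dist_set _ _).2|exists u, v]. Qed.

Lemma torus_dist_ge0 x y : 0 <= torus_dist x y.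
Proof.
apply: lb_le_inf; first exact: (has_inf_dist_set _ _).1.
by move=> _ [u [v [_ _ ->]]]; exact: eucl_norm_ge0.
Qed.

Lemma torus_dist_lt x y (e : R) : torus_dist x y < e ->
  exists u v : 'rV[R]_D, [/\ \pi_(torus R D) u = x, \pi_(torus R D) v = y
                          & eucl_norm (u - v) < e].
Proof.
move=> xye; have e0 : 0 < e - torus_dist x y by rewrite subr_gt0.
have [_ [u [v [ux vy ->]]]] := inf_adherent e0 (has_inf_dist_set x y).
by rewrite -/(torus_dist x y) subrKC => uve; exists u, v.
Qed.

Lemma torus_distxx x : torus_dist x x = 0.
Proof.
apply/eqP; rewrite eq_le torus_dist_ge0 andbT.
by rewrite -[x]reprK (le_trans (torus_dist_le _ _))// subrr eucl_norm0.
Qed.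

Lemma torus_dist_sym x y : torus_dist x y = torus_dist y x.
Proof.
congr inf; apply/seteqP; split => _ [u [v [ux vy ->]]];
by exists v, u; split=> //; rewrite -eucl_normN opprB.
Qed.

Lemma torus_dist_triangle y x z :
  torus_dist x z <= torus_dist x y + torus_dist y z.
Proof.
apply/ler_addgt0Pl => /= e e0.
have [|u [v [ux vy uv]]] := @torus_dist_lt x y (torus_dist x y + e / 2).
  by rewrite ltrDl divr_gt0.
have [|v' [w [vy' wz vw]]] := @torus_dist_lt y z (torus_dist y z + e / 2).
  by rewrite ltrDl divr_gt0.
have vv' : v - v' \is a mxOver (Num.int : {pred R}).
  by rewrite -torus_pi_eq vy vy'.
have wz' : \pi_(torus R D) (w + (v - v')) = z.
  by rewrite -wz; apply/eqP; rewrite torus_pi_eq addrAC subrr add0r.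
have := torus_dist_le u (w + (v - v')); rewrite ux wz'.
have -> : u - (w + (v - v')) = (u - v) + (v' - w).
  by apply/rowP => i; rewrite !mxE; ring.
by have := eucl_normD (u - v) (v' - w); lra.
Qed.

Lemma torus_dist_positivity x y : torus_dist x y = 0 -> x = y.
Proof.
move=> xy0.
have lt_ (e : R) : 0 < e -> exists w : 'rV[R]_D,
    \pi_(torus R D) w = x - y /\ eucl_norm w < e.
  rewrite -xy0 => /torus_dist_lt[u [v [<- <- uve]]].
  by exists (u - v); split=> //; rewrite raddfB.
have [w [wxy w4]] := lt_ (2^-1) ltac:(by rewrite invr_gt0).
suff w0 : w = 0.
  by apply/eqP; rewrite -subr_eq0 -wxy w0 raddf0.
apply/rowP => i; rewrite mxE; apply/eqP; rewrite -normr_le0.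
apply/ler_addgt0Pl => /= e e0; rewrite addr0.
have [w' [w'xy w'e]] : exists w' : 'rV[R]_D,
    \pi_(torus R D) w' = x - y /\ eucl_norm w' < Num.min e (2^-1).
  by apply: lt_; rewrite lt_min e0 invr_gt0/=.
move: w'e; rewrite lt_min => /andP[w'e w'2].
have /mxOverP/(_ 0 i) : w - w' \is a mxOver (Num.int : {pred R}).
  by rewrite -torus_pi_eq wxy w'xy.
rewrite !mxE => /norm_intr_ge1 ww'.
have [/eqP|/ww'] := eqVneq (w 0 i - w' 0 i) 0.
  rewrite subr_eq0 => /eqP ->.
  exact: le_trans (eucl_norm_coord _ _) (ltW w'e).
rewrite leNgt (le_lt_trans (ler_normB _ _))//.
have := eucl_norm_coord w i; have := eucl_norm_coord w' i; lra.
Qed.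

End TorusDist.

(* Provides torus R D with its topology as well. *)
HB.instance Definition _ (R : realType) (D : nat) :=
  @isMetric.Build R (torus R D) (@torus_dist R D) (@torus_distxx R D)
    (@torus_dist_positivity R D) (@torus_dist_sym R D)
    (@torus_dist_triangle R D).

Section ProdMetric.
Context (R : realType) (X Y : metricType R).

Definition prod_dist (p q : X * Y) : R :=
  Num.max (mdist p.1 q.1) (mdist p.2 q.2).

Lemma prod_dist_ge0 p q : 0 <= prod_dist p q.
Proof. by rewrite le_max mdist_ge0. Qed.

Lemma prod_dist_positivity p q : prod_dist p q = 0 -> p = q.
Proof.
move=> pq0; have : prod_dist p q <= 0 by rewrite pq0.
rewrite ge_max => /andP[p1 p2].
case: p q p1 p2 {pq0} => [a b] [c d]/= p1 p2.
by congr (_, _); apply: mdist_positivity; apply/eqP; rewrite eq_le mdist_ge0 andbT.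
Qed.

Lemma ball_prod_dist p d : ball p d = [set q | prod_dist p q < d].
Proof.
rewrite /ball/= /prod_ball; apply/seteqP; split => q/=.
  by rewrite !ballEmdist/= /prod_dist gt_max => -[-> ->].
by rewrite /prod_dist gt_max !ballEmdist/= => /andP[].
Qed.

End ProdMetric.

(* The library's product of pseudometric spaces carries the maximum metric. *)
HB.instance Definition _ (R : realType) (X Y : metricType R) :=
  @PseudoMetric_isMetric.Build R (X * Y)%type (@prod_dist R X Y)
    (@prod_dist_ge0 R X Y) (@prod_dist_positivity R X Y)
    (@ball_prod_dist R X Y).

Section Hausdorff.
Context (R : realType) (X : metricType R).
Local Open Scope ereal_scope.
Implicit Types (A : set X) (s delta : R).

(* diam set0 = -oo *)
Definition diam A : \bar R :=
  ereal_sup [set (mdist x y)%:E | x in A & y in A].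

(* |A|^s, where the empty set always contributes 0 and, for s = 0, every
   nonempty set contributes 1. *)
Definition diam_pow s A : \bar R :=
  if A == set0 then 0 else poweR (diam A) s.

(* Finite covers are sequences that are eventually empty. *)
Definition delta_cover delta A : set (nat -> set X) :=
  [set U | A `<=` \bigcup_n U n /\ forall n, diam (U n) <= delta%:E].

Definition hausdorff_premeasure s delta A : \bar R :=
  ereal_inf [set \sum_(0 <= n <oo) diam_pow s (U n) | U in delta_cover delta A].

(* The limit for delta -> 0+ is a supremum, by monotonicity in delta. *)
Definition hausdorff_measure s A : \bar R :=
  ereal_sup [set hausdorff_premeasure s delta A | delta in [set d : R | (0 < d)%R]].

(* The maximum with 0 encodes sup set0 = 0, the supremum being taken in
   [0, +oo]. *)
Definition hausdorff_dim A : \bar R :=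
  maxe 0 (ereal_sup
    [set s%:E | s in [set s : R | (0 <= s)%R /\ hausdorff_measure s A = +oo]]).

End Hausdorff.

Section SkewProducts.
Context (R : realType) (D : nat).
Local Notation torus := (torus R D).
Implicit Types (rho : 'rV[R]_D) (f : torus -> R -> R) (theta : torus).

Definition rotation rho (theta : torus) : torus :=
  theta + \pi_torus rho.

(* rho \in R^D \ Q^D *)
Definition irrational_vector rho : Prop :=
  ~ exists q : 'rV[rat]_D, rho = map_mx ratr q.

(* The space T^D x [0, 1], as a subset of T^D x R: fibre maps are functions on
   R of which only the restriction to [0, 1] matters. *)
Definition phase_space : set (torus * R^o) := [set: torus] `*` `[0, 1].

Definition skew_product rho f (p : torus * R^o) : torus * R^o :=
  (rotation rho p.1, f p.1 p.2).

(* g has derivative l at x relative to [0, 1] (one-sided at the endpoints) *)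
Definition has_derivative01 (g : R -> R) (x l : R) : Prop :=
  (g y - g x) / (y - x) @[y --> within `[0, 1] (x^')] --> l.

Definition pinched_at f theta : Prop :=
  exists x : R, f theta @` `[0, 1] = [set x].

Record class_T rho f : Prop := {
  class_T_irrational : irrational_vector rho ;
  class_T_fibre : forall theta, set_fun `[0, 1] `[0, 1] (f theta) ;
  class_T_monotone : forall theta,
    {in `[0, 1] &, {homo f theta : x y / x <= y}} ;
  class_T_derivative : exists2 df : torus * R^o -> R^o,
    (forall theta x, x \in `[0, 1] ->
      has_derivative01 (f theta) x (df (theta, x))) &
    {within phase_space, continuous df} ;
  class_T_pinched : exists theta_star, pinched_at f theta_star ;
  class_T_zero : forall theta, f theta 0 = 0 }.

Record Tstar_conditions rho f (theta_star : torus)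
    (alpha gamma L0 beta c d : R) (m : nat) (a b : R) : Prop := {
  Tstar_alpha : 2 < alpha ;
  Tstar_gamma : 0 < gamma ;
  Tstar_L0 : 0 < L0 < 1 ;
  Tstar_beta : 0 < beta ;
  Tstar_c : 0 < c ;
  Tstar_d : 1 < d ;
  Tstar_m : (0 < m)%N ;
  Tstar_a : 1 < a ;
  Tstar_b : 0 < b < 1 ;
  Tstar_expansion : forall theta, {in `[0, 1] &, forall x y,
    `|f theta x - f theta y| <= alpha * `|x - y|} ;
  Tstar_contraction : forall theta, {in `[L0, 1] &, forall x y,
    `|f theta x - f theta y| <= alpha `^ (- gamma) * `|x - y|} ;
  Tstar_lipschitz : forall theta theta', {in `[0, 1], forall x,
    `|f theta x - f theta' x| <= beta * mdist theta theta'} ;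
  Tstar_diophantine : forall n : nat, (0 < n)%N ->
    c * n%:R `^ (- d) <= mdist (iter n (rotation rho) theta_star) theta_star ;
  Tstar_m_large : 22 * (1 + 1 / gamma) < m%:R ;
  Tstar_a_large : (m.+1)%:R `^ d <= a ;
  Tstar_b_small : b <= c ;
  Tstar_no_return : forall n : nat, (1 <= n <= m.-1)%N ->
    b < mdist (iter n (rotation rho) theta_star) theta_star ;
  Tstar_lower : forall theta, {in `[0, 1], forall x,
    Num.min L0 (a * x) * Num.min 1 (2 / b * mdist theta theta_star)
      <= f theta x} }.

Definition class_Tstar rho f : Prop :=
  class_T rho f /\
  exists2 theta_star, pinched_at f theta_star &
  exists (alpha gamma L0 beta c d : R) (m : nat) (a b : R),
    Tstar_conditions rho f theta_star alpha gamma L0 beta c d m a b.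

Definition global_attractor (T : torus * R^o -> torus * R^o)
    : set (torus * R^o) :=
  \bigcap_(n in [set n | (0 < n)%N]) (iter n T @` phase_space).

Definition upper_bounding_function (T : torus * R^o -> torus * R^o)
    (theta : torus) : R :=
  sup [set x : R | x \in `[0, 1] /\ global_attractor T (theta, x)].

Definition upper_bounding_graph (T : torus * R^o -> torus * R^o)
    : set (torus * R^o) :=
  range (fun theta => (theta, upper_bounding_function T theta : R^o)).

End SkewProducts.

(* Main.v *)
Require Import Defs.
From mathcomp Require Import all_boot all_order all_algebra.
From mathcomp Require Import all_classical all_reals all_analysis.
From mathcomp Require Import generic_quotient ring_quotient.
From mathcomp Require Import ring lra zify.

(** The dimension is at least D because every graph over the torus projects onto
    the torus without increasing distances. Quantitatively, pulling a cover of
    the graph back to the cube [0, 1/2]^D and counting grid points shows that a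
    cover by sets of diameter at most delta has sum of s-th powers of order at
    least delta^(s - D) when s < D ([cube_cover_sum], [graph_cover_sum_ge]).

    For the upper bound, let phi_n(theta) be the image of 1 under the n-th iterate
    of the map over theta - n rho ([upper_line]). Since the fibre maps are
    continuous and non-decreasing and fix 0, the fibre of the attractor over theta
    consists of the points below all phi_n(theta) ([attractor_fibreE]). Call theta
    slow (with delay j) if for all i > j the point theta - i rho stays away from
    the critical point theta_star by at least (b/2) a^-(i %/ m).

    On a slow set the phi_n are Lipschitz uniformly in n ([upper_line_lipschitz]).
    Indeed an orbit of 1 can fall below L0 only by a visit to the ball of radius
    b/2 about theta_star, and a visit at distance (b/2) a^-q is made up for after
    about q steps, as away from that ball small values grow by the factor a. The
    Diophantine condition and a >= (m + 1)^d separate the visits of depth greater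
    than t by at least (m + 1)^t steps, or m steps for t = 0 ([depth_gap]), so
    that the depths of the visits within a window of length l add up to at most
    2 l / m plus the largest depth, which slowness bounds by a fraction 1 / m of
    the time ([sum_depth_le]). Hence over the last k steps the orbits of 1 towards
    theta and theta' are both in the contracting region [L0, 1], except for a
    proportion 8 / m of the steps and a bounded number of them
    ([expanding_count]). As m > 22 (1 + 1/gamma), the product of the Lipschitz
    constants decays exponentially in k ([prod_rate_le]), and the influence of the
    base point on the last steps sums up to a Lipschitz constant
    ([iterated_error_le]).

    The upper bounding function is therefore Lipschitz on each slow set, where its
    graph is null for the s-dimensional Hausdorff content, s > D. The base points
    in no slow set lie in infinitely many of the balls of radius
    (b/2) a^-(i %/ m) about theta_star + i rho. These radii are exponentially
    small, so the part of T^D x [0, 1] over such points is null for every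
    s > 1 ([content_null_limsup_balls]). *)

Set Implicit Arguments.
Unset Strict Implicit.
Unset Printing Implicit Defensive.

Import Order.TTheory GRing.Theory Num.Theory.
Import numFieldNormedType.Exports.

Local Open Scope classical_set_scope.
Local Open Scope ring_scope.
Local Open Scope quotient_scope.

(** * Covers of a cube *)

(** Below distance 1/2, the projection of R^D onto the torus does not shrink
    the coordinates in which two points differ by at most 1/2. *)
Lemma torus_dist_coord (R : realType) (D : nat) (u v : 'rV[R]_D) (i : 'I_D)
    (e : R) :
  `|u 0 i - v 0 i| <= 2^-1 -> e <= 2^-1 ->
  torus_dist (\pi_(torus R D) u) (\pi_(torus R D) v) < e ->
  `|u 0 i - v 0 i| < e.
Proof.
move=> uv2 e2 /torus_dist_lt[u' [v' [/eqP u'u /eqP v'v u'v'e]]].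
move: u'u v'v; rewrite !torus_pi_eq => /mxOverP/(_ 0 i) + /mxOverP/(_ 0 i).
rewrite !mxE => uZ vZ; have := rpredB uZ vZ => zZ.
have ce : `|u' 0 i - v' 0 i| < e.
  by apply: le_lt_trans u'v'e; have := eucl_norm_coord (u' - v') i; rewrite !mxE.
have [z0|/(norm_intr_ge1 zZ)] := eqVneq (u' 0 i - u 0 i - (v' 0 i - v 0 i)) 0.
  suff -> : u 0 i - v 0 i = u' 0 i - v' 0 i by [].
  by lra.
rewrite leNgt => /negP[].
rewrite (_ : _ - _ = (u' 0 i - v' 0 i) - (u 0 i - v 0 i)); last by ring.
by rewrite (le_lt_trans (ler_normB _ _))//; lra.
Qed.

Lemma card_ord_diam_le (N L : nat) (P : {set 'I_N}) :
  {in P &, forall i j : 'I_N, (i <= j + L)%N} -> (#|P| <= L.+1)%N.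
Proof.
move=> PL; have [->|[i0 i0P]] := set_0Vmem P; first by rewrite cards0.
case: (arg_minnP (fun i : 'I_N => i : nat) i0P) => i iP imin.
rewrite cardE -(size_map (fun i : 'I_N => i : nat)) -(size_iota i L.+1).
apply: uniq_leq_size; first by rewrite map_inj_uniq ?enum_uniq//; exact: val_inj.
move=> x /mapP[j]; rewrite mem_enum => jP ->; rewrite mem_iota imin//=.
by rewrite addnS ltnS PL.
Qed.

(** At most (4 r N + 1)^D points of the grid (1/(2N)) {0, ..., N-1}^D lie in a
    cube of half-side r. *)
Lemma card_grid_cube (R : realType) (D N : nat) (x : 'rV[R]_D) (r : R) :
  (0 < N)%N -> 0 < r ->
  #|[set k : {ffun 'I_D -> 'I_N} |
      [forall i, `|x 0 i - (k i)%:R / (2 * N%:R)| < r]]%SET|%:R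
  <= (4 * r * N%:R + 1) ^+ D.
Proof.
move=> N0 r0.
pose P i := [set k : 'I_N | `|x 0 i - k%:R / (2 * N%:R)| < r]%SET.
have -> : [set k : {ffun 'I_D -> 'I_N} |
      [forall i, `|x 0 i - (k i)%:R / (2 * N%:R)| < r]]%SET =
    [set k | k \in family P]%SET.
  apply/finset.setP => k; rewrite !inE; apply/forallP/familyP => h i;
    by have := h i; rewrite inE.
have N2 : 0 < 2 * N%:R :> R by rewrite mulr_gt0// ltr0n.
have r4 : 0 <= 4 * r * N%:R by rewrite mulr_ge0 ?ler0n// mulr_ge0// ltW.
rewrite cardsE card_family foldrE big_map natr_prod big_enum/=.
rewrite -[X in _ <= _ ^+ X]card_ord -prodr_const; apply: ler_prod => i _.
rewrite ler0n/=; apply: (@le_trans _ _ (Num.truncn (4 * r * N%:R)).+1%:R).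
  rewrite ler_nat; apply: card_ord_diam_le => j k; rewrite !inE => xj xk.
  suff : (j - k <= Num.truncn (4 * r * N%:R))%N by rewrite leq_subLR.
  case: (leqP j k) => [jk|kj]; first by rewrite (eqP jk).
  rewrite truncn_ge_nat// natrB ?(ltnW kj)//.
  have : `|j%:R / (2 * N%:R) - k%:R / (2 * N%:R) : R| <= 2 * r.
    rewrite (_ : _ - _ = (x 0 i - k%:R / (2 * N%:R)) - (x 0 i - j%:R / (2 * N%:R))); last by ring.
    by rewrite (le_trans (ler_normB _ _))//; lra.
  move/(le_trans (ler_norm _)); rewrite -mulrBl ler_pdivrMr//.
  by move=> /le_trans; apply; rewrite le_eqVlt; apply/orP; left; apply/eqP; ring.
by rewrite -natr1 lerD2r; have /andP[] := truncn_itv r4.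
Qed.

(** A countable cover of the cube [0, 1/2]^D by balls of the supremum norm
    cannot have too small radii. *)
Lemma cube_cover_sum (R : realType) (D : nat) (x : nat -> 'rV[R]_D)
    (r : nat -> R) :
  (forall n, 0 < r n) ->
  (forall u : 'rV[R]_D, (forall i, 0 <= u 0 i <= 2^-1) ->
     exists n, forall i, `|x n 0 i - u 0 i| < r n) ->
  exists N, 1 <= \sum_(n < N) (5 * r n) ^+ D.
Proof.
move=> r0 cov.
have K := @rV_compact R D (fun=> `[0, 2^-1]%classic) (fun=> @segment_compact R 0 (2^-1)).
move: K; rewrite compact_cover => /(_ nat setT (fun n => (ball (x n) (r n))^°)).
case.
- by move=> n _; exact: open_interior.
- move=> u/= uK; have [|n xu] := cov u.
    by move=> i; have := uK i; rewrite /= in_itv.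
  exists n => //; rewrite /interior/=.
  have o : open (ball (x n) (r n)) by apply: ball_open; exact: r0.
  apply: open_nbhs_nbhs; split => //.
  by split=> // i j; rewrite (ord1 i); exact: xu.
move=> F _ Fcov.
(* The finite subcover uses indices below M only; the grid is finer than all
   radii involved. *)
pose M := (\max_(n <- finmap.enum_fset F) n).+1; exists M.
pose rmin := \big[Num.min/1]_(n < M) r n.
have rmin0 : 0 < rmin by apply/bigmin_gtP; split.
pose N := (Num.truncn rmin^-1).+1.
have N0 : 0 < N%:R :> R by rewrite ltr0n.
have rN (n : 'I_M) : 1 <= r n * N%:R.
  apply: (@le_trans _ _ (rmin * N%:R)); last first.
    by rewrite ler_wpM2r//; exact: bigmin_le_cond.
  by rewrite -ler_pdivrMl// mulr1 ltW// truncnS_gt.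
pose B (n : 'I_M) := [set k : {ffun 'I_D -> 'I_N} |
      [forall i, `|x n 0 i - (k i)%:R / (2 * N%:R)| < r n]]%SET.
have cB : ((#|{ffun 'I_D -> 'I_N}|) <= \sum_(n < M) #|B n|)%N.
  rewrite -cardsT; apply: (@leq_trans #|(\bigcup_(n < M) B n)%SET|); last first.
    apply: (big_ind2 (fun (A : {set {ffun 'I_D -> 'I_N}}) k => #|A| <= k)%N) => //.
      by rewrite cards0.
    move=> A k A' k' Ak A'k'; rewrite (leq_trans (leq_card_setU _ _))//.
    exact: leq_add.
  apply/subset_leq_card/fintype.subsetP => k _; apply/finset.bigcupP.
  have [|n/= nF] := Fcov (\row_i ((k i)%:R / (2 * N%:R))).
    move=> i; rewrite /= in_itv/= mxE divr_ge0//=.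
    rewrite ler_pdivrMr; last by rewrite mulr_gt0.
    by rewrite mulKf// ler_nat ltnW.
  have nM : (n < M)%N by rewrite ltnS; exact: (@leq_bigmax_seq _ _ predT id n nF).
  move=> /interior_subset[_ kn]; exists (Ordinal nM) => //.
  rewrite inE; apply/forallP => i; have := kn 0 i.
  by rewrite !mxE.
have : (N ^ D)%:R <= \sum_(n < M) (5 * r n * N%:R) ^+ D :> R.
  apply: (@le_trans _ _ (\sum_(n < M) #|B n|)%N%:R).
    by rewrite ler_nat; rewrite card_ffun !card_ord in cB.
  rewrite natr_sum; apply: ler_sum => n _.
  apply: (le_trans (card_grid_cube _ _ _)) => //.
  apply: lerXn2r; rewrite ?nnegrE.
  - by rewrite addr_ge0// mulr_ge0// ?ltW// mulr_gt0.
  - by rewrite mulr_ge0// ?ltW// mulr_gt0.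
  - by have := rN n; lra.
under eq_bigr do rewrite exprMn.
by rewrite -mulr_suml natrX -ler_pdivrMr ?exprn_gt0// divff// ?gt_eqF ?exprn_gt0.
Qed.

(** * Lower bound for the dimension of a graph *)

Section HausdorffCovers.
Context (R : realType) (X : metricType R).
Implicit Types (A U : set X) (s : R).

Lemma diam_ge0 U x : U x -> (0 <= diam U)%E.
Proof.
by move=> Ux; apply: ereal_sup_ubound; exists x => //; exists x => //; rewrite mdistxx.
Qed.

Lemma mdist_le_diam U x y : U x -> U y -> ((mdist x y)%:E <= diam U)%E.
Proof. by move=> Ux Uy; apply: ereal_sup_ubound; exists x => //; exists y. Qed.

Lemma diam_set0 : diam (set0 : set X) = -oo%E.
Proof.
rewrite /diam (_ : [set _ | _ in _ & _ in _] = set0) ?ereal_sup0//.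
by apply/seteqP; split => // z [x []].
Qed.

Lemma diam_pow_ge0 s U : (0 <= diam_pow s U)%E.
Proof. by rewrite /diam_pow; case: ifPn => // _; exact: poweR_ge0. Qed.

Lemma diam_pow_fine s U : (diam U < +oo)%E -> 0 < fine (diam U) ->
  diam_pow s U = (fine (diam U) `^ s)%:E.
Proof.
rewrite /diam_pow; case: ifPn => [/eqP -> _|]; last first.
  by case: (diam U) => [r _ _ _| |]//=; rewrite ltxx.
by rewrite diam_set0 /= ltxx.
Qed.

End HausdorffCovers.

Lemma sum_geometric_le (R : realFieldType) (q : R) (N : nat) : 0 <= q < 1 ->
  \sum_(n < N) q ^+ n <= (1 - q)^-1.
Proof.
move=> /andP[q0 q1]; rewrite -div1r ler_pdivlMr ?subr_gt0// mulrC.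
rewrite -opprB mulNr -subrX1; have := exprn_ge0 N q0; lra.
Qed.

Lemma sum_half_le2 (R : realFieldType) (N : nat) :
  \sum_(n < N) (2^-1 : R) ^+ n <= 2.
Proof.
have h : 0 <= (2^-1 : R) < 1 by apply/andP; split; lra.
rewrite (le_trans (sum_geometric_le N h))//.
by rewrite (_ : 1 - 2^-1 = 2^-1 :> R) ?invrK//; lra.
Qed.

(** Any graph over the D-dimensional torus has large s-dimensional content at
    small scales when s < D. *)
Lemma graph_cover_sum_ge (R : realType) (D : nat) (phi : torus R D -> R^o)
    (s delta : R) (U : nat -> set (torus R D * R^o)) :
  (0 < D)%N -> s <= D%:R -> 0 < delta <= 4^-1 ->
  delta_cover delta (range (fun theta => (theta, phi theta))) U ->
  (((2 * 10 ^+ D * delta `^ (D%:R - s))^-1)%:E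
     <= \sum_(0 <= n <oo) diam_pow s (U n))%E.
Proof.
move=> D0 sD /andP[delta0 delta4] [cov dU].
pose d n := fine (diam (U n)).
have ddelta n : d n <= delta.
  have := dU n; rewrite /d; case: (diam (U n)) => //= _; exact: ltW.
have dist_d n p q : U n p -> U n q -> mdist p q <= d n.
  move=> Up Uq; have := mdist_le_diam Up Uq; have := dU n.
  by rewrite /d; case: (diam (U n)).
(* A set of diameter zero is enclosed in a cube of negligible size. *)
pose r n := if 0 < d n then 2 * d n else 20^-1 * 2^-1 ^+ n.
have r0 n : 0 < r n.
  rewrite /r; case: ifPn => [dn|_]; first by rewrite mulr_gt0.
  by rewrite mulr_gt0 ?invr_gt0// exprn_gt0.
have half1 n : 2^-1 ^+ n <= 1 :> R by rewrite exprn_ile1// invf_le1// ler1n.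
have r2 n : r n <= 2^-1.
  rewrite /r; case: ifPn => _; first by have := ddelta n; lra.
  by have := half1 n; lra.
have dr n : d n < r n.
  rewrite /r; case: ifPn => [dn|]; first by lra.
  rewrite -leNgt => /le_lt_trans; apply.
  by rewrite mulr_gt0 ?invr_gt0// exprn_gt0.
pose V n := [set u : 'rV[R]_D | (forall i, 0 <= u 0 i <= 2^-1) /\
  U n (\pi_(torus R D) u, phi (\pi_(torus R D) u))].
have [|N] := @cube_cover_sum R D (fun n => xget 0 (V n)) r r0.
  move=> u u01.
  have [|n _ Un] := cov (\pi_(torus R D) u, phi (\pi_(torus R D) u)).
    by exists (\pi_(torus R D) u).
  have Vu : V n u by split.
  exists n => i; have [v01 Uv] : V n (xget 0 (V n)) by exact: xgetI Vu.
  apply: torus_dist_coord => //.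
    by have := u01 i; have := v01 i; rewrite ler_norml; lra.
  apply: le_lt_trans (dr n); apply: le_trans (dist_d _ _ _ Uv Un).
  by rewrite /mdist/= le_max lexx.
set C := 10 ^+ D * delta `^ (D%:R - s).
have C0 : 0 < C by rewrite mulr_gt0 ?exprn_gt0 ?powR_gt0.
have term n : (((5 * r n) ^+ D)%:E <=
    C%:E * diam_pow s (U n) + (4^-1 * 2^-1 ^+ n)%:E)%E.
  rewrite /r; case: ifPn => dn.
    rewrite diam_pow_fine ?(le_lt_trans (dU n)) ?ltry// -/(d n).
    rewrite -EFinM -EFinD lee_fin (@le_trans _ _ (C * d n `^ s))//; last first.
      by rewrite lerDl mulr_ge0 ?exprn_ge0.
    rewrite mulrA (_ : 5 * 2 = 10 :> R); last by ring.
    rewrite exprMn -mulrA ler_pM2l ?exprn_gt0// -powR_mulrn ?(ltW dn)//.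
    rewrite -[X in _ `^ X <= _](subrK s) powRD; last by rewrite (gt_eqF dn) implybT.
    apply: ler_wpM2r; first exact: powR_ge0.
    by apply: ge0_ler_powR; rewrite ?nnegrE ?subr_ge0 ?(ltW dn) ?(ltW delta0).
  rewrite (@le_trans _ _ ((4^-1 * 2^-1 ^+ n)%:E))//; last first.
    by rewrite leeDr// mule_ge0 ?diam_pow_ge0// lee_fin ltW.
  rewrite lee_fin (_ : 5 * _ = 4^-1 * 2^-1 ^+ n); last by field.
  have h0 : 0 <= 4^-1 * 2^-1 ^+ n :> R by rewrite mulr_ge0 ?exprn_ge0.
  by rewrite -[leRHS]expr1 ler_wiXn2l//; have := half1 n; lra.
move=> sum1.
have : (1%:E <= C%:E * (\sum_(0 <= n <oo) diam_pow s (U n)) + (2^-1)%:E)%E.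
  apply: (@le_trans _ _ (\sum_(n < N) ((5 * r n) ^+ D)%:E)%E).
    by rewrite sumEFin lee_fin.
  apply: (@le_trans _ _ (\sum_(n < N)
      (C%:E * diam_pow s (U n) + (4^-1 * 2^-1 ^+ n)%:E))%E).
    by apply: lee_sum => n _; exact: term.
  rewrite big_split/= leeD//.
    rewrite -ge0_sume_distrr; last by move=> *; exact: diam_pow_ge0.
    rewrite lee_pmul2l ?lte_fin ?fin_numE//.
    rewrite -(big_mkord xpredT (fun n => diam_pow s (U n))).
    apply: nneseries_lim_ge => n _ _; exact: diam_pow_ge0.
  rewrite sumEFin lee_fin -mulr_sumr.
  by have := sum_half_le2 R N; lra.
have : (0 <= \sum_(0 <= n <oo) diam_pow s (U n))%E.
  by apply: nneseries_ge0 => n _ _; exact: diam_pow_ge0.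
case: (\sum_(0 <= n <oo) _)%E => [S| |]// S0; last by rewrite leey.
rewrite -EFinM -EFinD !lee_fin => CS.
rewrite -mulrA -/C -div1r ler_pdivrMr ?mulr_gt0 ?powR_gt0//; lra.
Qed.

Lemma graph_hausdorff_measure_pinfty (R : realType) (D : nat)
    (phi : torus R D -> R^o) (s : R) : (0 < D)%N -> s < D%:R ->
  hausdorff_measure s (range (fun theta => (theta, phi theta))) = +oo%E.
Proof.
move=> D0 sD; apply: eq_infty => M.
wlog M0 : M / 0 < M.
  move=> /(_ (Num.max M 1)); rewrite lt_max ltr01 orbT => /(_ isT).
  by apply: le_trans; rewrite lee_fin le_max lexx.
have Ds : 0 < D%:R - s by rewrite subr_gt0.
pose K : R := (2 * 10 ^+ D * M)^-1.
have K0 : 0 < K by rewrite invr_gt0 mulr_gt0// mulr_gt0// exprn_gt0.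
pose delta := Num.min 4^-1 (K `^ (D%:R - s)^-1).
have delta0 : 0 < delta by rewrite lt_min invr_gt0 ltr0n/= powR_gt0.
apply: (@le_trans _ _ (hausdorff_premeasure s delta
    (range (fun theta => (theta, phi theta))))); last first.
  by apply: ereal_sup_ubound; exists delta.
apply: le_ereal_inf_tmp => _ [U Ucov <-].
apply: le_trans (graph_cover_sum_ge D0 (ltW sD) _ Ucov); last first.
  by rewrite delta0 ge_min lexx.
have : delta `^ (D%:R - s) <= K.
  rewrite (_ : K = (K `^ (D%:R - s)^-1) `^ (D%:R - s)); last first.
    by rewrite -powRrM mulVf ?gt_eqF// powRr1// ltW.
  apply: ge0_ler_powR; rewrite ?nnegrE ?powR_ge0 ?(ltW Ds) ?(ltW delta0)//.
  by rewrite ge_min lexx orbT.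
rewrite /K -[in X in _ -> X](invrK M) lee_fin => dK.
rewrite lef_pV2 ?posrE ?invr_gt0 ?mulr_gt0 ?exprn_gt0 ?powR_gt0//.
apply: le_trans (ler_wpM2l _ dK) _; first by rewrite mulr_ge0 ?exprn_ge0.
by rewrite invfM mulrA divff ?mul1r// gt_eqF// mulr_gt0 ?exprn_gt0.
Qed.

Lemma graph_hausdorff_dim_ge (R : realType) (D : nat) (phi : torus R D -> R^o) :
  (0 < D)%N ->
  (D%:R%:E <= hausdorff_dim (range (fun theta => (theta, phi theta))))%E.
Proof.
move=> D0; rewrite /hausdorff_dim; apply/lee_subgt0Pr => /= e e0.
rewrite le_max; have [s0|s0] := ltP (D%:R - e) 0; apply/orP; [left|right].
  by rewrite lee_fin ltW.
apply: ereal_sup_ubound; exists (D%:R - e) => //; split => //.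
by apply: graph_hausdorff_measure_pinfty => //; rewrite gtrBl.
Qed.

(** * Hausdorff content *)

Lemma sum_ltn (N K : nat) : (\sum_(0 <= n < N) (n < K) = minn N K)%N.
Proof.
elim: N => [|N IH]; first by rewrite big_nil min0n.
by rewrite big_nat_recr//= IH; case: ltnP; lia.
Qed.

Section Content.
Context (R : realType) (X : metricType R).
Implicit Types (A B : set X) (s e : R).

Lemma nneseries_le (u : nat -> \bar R) (x : \bar R) : (forall n, 0 <= u n)%E ->
  (forall N, \sum_(0 <= n < N) u n <= x)%E -> (\sum_(0 <= n <oo) u n <= x)%E.
Proof.
move=> u0 ux; apply: lime_le; first by apply: is_cvg_nneseries => n _ _; exact: u0.
exact: nearW.
Qed.

(** The s-dimensional Hausdorff content of A, for which covers are not
    restricted to small sets, is at most e, and this is witnessed by a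
    cover. *)
Definition content_le s A e : Prop :=
  exists U : nat -> set X, A `<=` \bigcup_n U n /\
    (\sum_(0 <= n <oo) diam_pow s (U n) <= e%:E)%E.

(** A has s-dimensional Hausdorff content zero. *)
Definition content_null s A : Prop := forall e, 0 < e -> content_le s A e.

Lemma content_le_sub s A B e e' : A `<=` B -> e <= e' ->
  content_le s B e -> content_le s A e'.
Proof.
move=> AB ee' [U [BU Ue]]; exists U; split; first exact: subset_trans BU.
by rewrite (le_trans Ue)// lee_fin.
Qed.

Lemma content_le_bigcup s (A : nat -> set X) (e : nat -> R) (E : R) :
  (forall n, content_le s (A n) (e n)) ->
  (forall N, \sum_(n < N) e n <= E) ->
  content_le s (\bigcup_n A n) E.
Proof.
move=> /choice[U AU] eE.
(* The double family of covering sets is enumerated along a bijection g. *)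
have /card_esym/ppcard_eqP[g] := card_nat2.
pose W (p : nat * nat) := U p.1 p.2.
exists (fun k => W (g k)); split.
  move=> x [n _ Anx]; have [/(_ x Anx)[i _ Ux] _] := AU n.
  exists (g^-1%FUN (n, i)) => //=.
  by rewrite invK ?inE.
have W0 p : (0 <= diam_pow s (W p))%E by exact: diam_pow_ge0.
rewrite nneseries_esumT//.
rewrite -(@reindex_esum R _ _ [set: nat] [set: nat * nat] g (fun p => diam_pow s (W p)));
  last exact: bij.
rewrite (_ : [set: nat * nat] = [set: nat] `*`` (fun=> [set: nat])); last first.
  by apply/seteqP; split.
rewrite -(@esum_esum R _ _ _ _ (fun n i => diam_pow s (U n i))); last first.
  by move=> *; exact: diam_pow_ge0.
have U0 n : (0 <= \esum_(j in [set: nat]) diam_pow s (U n j))%E.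
  by apply: esum_ge0 => j _; exact: diam_pow_ge0.
rewrite -nneseries_esumT//; apply: nneseries_le => // N.
rewrite (@le_trans _ _ (\sum_(0 <= n < N) (e n)%:E)%E)//.
  apply: lee_sum => n _; rewrite -nneseries_esumT; first exact: (AU n).2.
  by move=> k; exact: diam_pow_ge0.
by rewrite sumEFin lee_fin big_mkord.
Qed.

Lemma content_null_bigcup s (A : nat -> set X) :
  (forall n, content_null s (A n)) -> content_null s (\bigcup_n A n).
Proof.
move=> A0 e e0; apply: (@content_le_bigcup _ _ (fun n => e / 2 * 2^-1 ^+ n)).
  by move=> n; apply: A0; rewrite mulr_gt0 ?divr_gt0 ?exprn_gt0.
move=> N; rewrite -mulr_sumr; have := sum_half_le2 R N => h.
by rewrite -[leRHS](@divfK _ 2)// ler_pM2l// divr_gt0.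
Qed.

(** Covers whose sum is small consist of small sets, as s > 0. *)
Lemma content_null_hausdorff s A : 0 < s -> content_null s A ->
  (hausdorff_measure s A < +oo)%E.
Proof.
move=> s0 A0; apply: (@le_lt_trans _ _ 1%E); last by rewrite ltry.
apply: ge_ereal_sup => _ [delta/= delta0 <-].
have m0 : 0 < Num.min 1 (delta `^ s) by rewrite lt_min ltr01 powR_gt0.
have [U [AU US]] := A0 _ m0.
apply: (@le_trans _ _ (\sum_(0 <= n <oo) diam_pow s (U n))%E); last first.
  by rewrite (le_trans US)// lee_fin ge_min lexx.
apply: ereal_inf_lbound; exists U => //; split => // n.
have : (diam_pow s (U n) <= (delta `^ s)%:E)%E.
  apply: (@le_trans _ _ (\sum_(0 <= n <oo) diam_pow s (U n))%E); last first.
    by rewrite (le_trans US)// lee_fin ge_min lexx orbT.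
  apply: (@le_trans _ _ (\sum_(0 <= k < n.+1) diam_pow s (U k))%E); last first.
    by apply: nneseries_lim_ge => k _ _; exact: diam_pow_ge0.
  by rewrite big_nat_recr//= leeDr// sume_ge0// => k _; exact: diam_pow_ge0.
rewrite /diam_pow; case: ifPn => [/eqP -> _|/set0P[x Ux]].
  by rewrite diam_set0 leNye.
have := diam_ge0 Ux; case: (diam (U n)) => [r| |]//=; last first.
  by rewrite /poweR gt_eqF.
rewrite !lee_fin => r0; apply: contraTT; rewrite -!ltNge => dr.
by rewrite gt0_ltr_powR// nnegrE ?ltW.
Qed.

(** Finitely many sets of diameter at most d. *)
Lemma content_le_fin s A (I : finType) (B : I -> set X) (d : R) : 0 <= s ->
  (forall x, A x -> exists i, B i x) ->
  (forall i x y, B i x -> B i y -> mdist x y <= d) ->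
  content_le s A (#|I|%:R * d `^ s).
Proof.
move=> s0 AB Bd.
pose U n := if (insub n : option 'I_#|I|) is Some i then B (enum_val i) else set0.
exists U; split.
  move=> x /AB[i Bix]; exists (enum_rank i) => //.
  by rewrite /U valK enum_rankK.
have Ud n : (diam_pow s (U n) <= ((n < #|I|)%N%:R * d `^ s)%:E)%E.
  rewrite /U; case: insubP => [i -> _|_]; last first.
    by rewrite /diam_pow eqxx lee_fin mulr_ge0// powR_ge0.
  rewrite mul1r /diam_pow; case: ifPn => [_|/set0P[x Bx]].
    by rewrite lee_fin powR_ge0.
  have : (diam (B (enum_val i)) <= d%:E)%E.
    by apply: ge_ereal_sup => _ [y By [z Bz <-]]; rewrite lee_fin (Bd _ _ _ By Bz).
  have := diam_ge0 Bx; case: (diam _) => //= r; rewrite !lee_fin => r0 rd.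
  by rewrite ge0_ler_powR// nnegrE// (le_trans r0).
apply: nneseries_le => [n|N]; first exact: diam_pow_ge0.
apply: (@le_trans _ _ (\sum_(0 <= n < N) ((n < #|I|)%N%:R * d `^ s)%:E)%E).
  by apply: lee_sum => n _; exact: Ud.
rewrite sumEFin lee_fin -mulr_suml ler_wpM2r ?powR_ge0//.
by rewrite -natr_sum ler_nat sum_ltn geq_minr.
Qed.

End Content.

(** * Two kinds of null sets *)

Lemma eucl_norm_le (R : realType) (D : nat) (u : 'rV[R]_D) (e : R) : 0 <= e ->
  (forall i, `|u 0 i| <= e) -> eucl_norm u <= D%:R * e.
Proof.
move=> e0 ue; rewrite /eucl_norm -(ger0_norm (mulr_ge0 (ler0n R D) e0)) -sqrtr_sqr.
apply: ler_wsqrtr; apply: (@le_trans _ _ (\sum_(i < D) e ^+ 2)).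
  by apply: ler_sum => i _; rewrite -real_normK ?num_real// lerXn2r ?nnegrE.
rewrite sumr_const card_ord -[leLHS]mulr_natl exprMn ler_wpM2r ?sqr_ge0//.
by rewrite -natrX ler_nat; case: (D) => // k; rewrite expnS leq_pmulr// expn_gt0.
Qed.

Lemma torus_repr01 (R : realType) (D : nat) (theta : torus R D) :
  exists u : 'rV[R]_D, \pi_(torus R D) u = theta /\ forall i, 0 <= u 0 i < 1.
Proof.
exists (\row_i (repr theta 0 i - (Num.floor (repr theta 0 i))%:~R)); split.
  rewrite -[RHS]reprK; apply/eqP; rewrite torus_pi_eq; apply/mxOverP => i j.
  by rewrite !mxE (ord1 i) addrC addKr rpredN intr_int.
move=> i; rewrite mxE; have /andP[] := floor_itv (repr theta 0 i).
by rewrite intrD; lra.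
Qed.

(** A Lipschitz graph over a subset of the D-dimensional torus is covered by
    N^D sets of diameter O(1/N), one over each cube of a grid, and
    N^D (1/N)^s tends to 0 when s > D. *)
Lemma content_null_lipschitz_graph (R : realType) (D : nat)
    (phi : torus R D -> R^o) (S : set (torus R D)) (K s : R) :
  D%:R < s -> (forall theta theta', S theta -> S theta' ->
    `|phi theta - phi theta'| <= K * mdist theta theta') ->
  content_null s [set (theta, phi theta : R^o) | theta in S].
Proof.
move=> Ds Sphi e e0.
have s0 : 0 < s by rewrite (le_lt_trans _ Ds).
have sD : 0 < s - D%:R by rewrite subr_gt0.
pose K1 := (1 + `|K|) * D.+1%:R.
have K10 : 0 < K1 by rewrite mulr_gt0// ltr_pwDl.
pose x := (K1 `^ s / e) `^ (s - D%:R)^-1.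
pose N := (Num.truncn x).+1.
have N0 : 0 < N%:R :> R by rewrite ltr0n.
have xN : x <= N%:R by rewrite ltW// truncnS_gt.
pose B (k : {ffun 'I_D -> 'I_N}) := [set p : torus R D * R^o |
  [/\ S p.1, p.2 = phi p.1 & exists u : 'rV[R]_D, \pi_(torus R D) u = p.1 /\
   forall i, (k i)%:R / N%:R <= u 0 i <= (k i).+1%:R / N%:R]].
apply: (content_le_sub (@subset_refl _ _) _
  (@content_le_fin _ _ _ _ _ B (K1 / N%:R) (ltW s0) _ _)) => //.
- rewrite card_ffun !card_ord natrX powRM ?(ltW K10) ?invr_ge0 ?(ltW N0)//.
  rewrite -powR_inv1 ?(ltW N0)// -powRrM mulN1r -powR_mulrn ?(ltW N0)//.
  rewrite mulrCA -powRD; last by rewrite (gt_eqF N0) implybT.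
  have : x `^ (s - D%:R) <= N%:R `^ (s - D%:R).
    by apply: ge0_ler_powR; rewrite ?nnegrE ?powR_ge0 ?(ltW sD) ?(ltW N0).
  rewrite /x -powRrM mulVf ?gt_eqF// powRr1; last first.
    by rewrite divr_ge0 ?powR_ge0// ltW.
  rewrite -(opprB s) powRN ler_pdivrMr// => h.
  by rewrite ler_pdivrMr ?powR_gt0// mulrC.
- move=> _ [theta Sth <-]; have [u [utheta u01]] := torus_repr01 theta.
  have Nu i : (Num.truncn (u 0 i * N%:R)%R < N)%N.
    have /andP[u0 u1] := u01 i; rewrite truncn_lt_nat ?mulr_ge0//.
    by rewrite gtr_pMl.
  exists [ffun i => Ordinal (Nu i)]; split => //=; exists u; split => // i.
  have /andP[u0 u1] := u01 i.
  have /andP[] := truncn_itv (mulr_ge0 u0 (ltW N0)).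
  by rewrite !ffunE/= ler_pdivrMr// ler_pdivlMr// => -> /ltW ->.
- move=> k [t1 y1] [t2 y2] [/= S1 y1E [u1 [u1t u1k]]] [/= S2 y2E [u2 [u2t u2k]]].
  have t12 : mdist t1 t2 <= D.+1%:R / N%:R.
    rewrite -u1t -u2t; apply: le_trans (torus_dist_le _ _) _.
    apply: (@le_trans _ _ (D%:R * N%:R^-1)); last first.
      by rewrite ler_wpM2r ?invr_ge0// ler_nat.
    apply: eucl_norm_le; first by rewrite invr_ge0.
    move=> i; rewrite !mxE; have := u1k i; have := u2k i.
    rewrite -natr1 mulrDl div1r ler_norml; lra.
  have tK : mdist t1 t2 <= K1 / N%:R.
    apply: le_trans t12 _; rewrite ler_wpM2r ?invr_ge0// /K1 ler_peMl// lerDl//.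
  rewrite /mdist/= /prod_dist/= ge_max tK/= /mdist/= y1E y2E.
  rewrite distrC; apply: le_trans (Sphi _ _ S1 S2) _.
  apply: (@le_trans _ _ ((1 + `|K|) * mdist t1 t2)).
    by rewrite ler_wpM2r ?mdist_ge0//; have := ler_norm K; lra.
  by rewrite /K1 -mulrA ler_wpM2l.
Qed.

(** Cut the cylinder over a ball of radius r into slices of height r. *)
Lemma content_ball_strip (R : realType) (D : nat) (tau : torus R D) (r s : R) :
  0 <= s -> 0 < r <= 1 ->
  content_le s [set p : torus R D * R^o | mdist p.1 tau < r /\ 0 <= p.2 <= 1]
    (2 / r * (2 * r) `^ s).
Proof.
move=> s0 /andP[r0 r1]; pose N := (Num.truncn r^-1).+1.
pose B (k : 'I_N) := [set p : torus R D * R^o | mdist p.1 tau < r /\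
  k%:R * r <= p.2 <= k.+1%:R * r].
apply: (content_le_sub (@subset_refl _ _) _
  (@content_le_fin _ _ _ _ _ B (2 * r) s0 _ _)) => //.
- rewrite card_ord ler_wpM2r ?powR_ge0// -[leLHS]natr1.
  have := truncn_itv (ltW (_ : 0 < r^-1)); rewrite invr_gt0 => /(_ r0)/andP[+ _].
  have : 1 <= r^-1 by rewrite invf_ge1.
  by lra.
- move=> [t y]/= [tr /andP[y0 y1]].
  have yr0 : 0 <= y / r by rewrite divr_ge0// ltW.
  have /andP[ty yt] := truncn_itv yr0.
  have Ny : (Num.truncn (y / r)%R < N)%N.
    by rewrite ltnS; apply: le_truncn; rewrite ler_pdivrMr// mulVf// gt_eqF.
  exists (Ordinal Ny); split => //=.
  by rewrite -ler_pdivlMr// ty/= -ler_pdivrMr// ltW.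
- move=> k [t1 y1] [t2 y2] [/= t1r y1k] [/= t2r y2k].
  rewrite /mdist/= /prod_dist/= ge_max; apply/andP; split.
    have := torus_dist_triangle tau t1 t2; have := torus_dist_sym tau t2.
    move: t1r t2r; rewrite /mdist/=; lra.
  move: y1k y2k; rewrite -natr1 /mdist/= ler_norml; lra.
Qed.

(** The part of T^D x [0, 1] over the limit superior of exponentially small
    balls is null for every exponent above 1. *)
Lemma content_null_limsup_balls (R : realType) (D : nat)
    (tau : nat -> torus R D) (r : nat -> R) (C q s : R)
    (A : set (torus R D * R^o)) :
  1 < s -> 0 < q < 1 -> (forall i, 0 < r i <= 1) ->
  (forall i, r i <= C * q ^+ i) ->
  (forall p, A p -> 0 <= p.2 <= 1) ->
  (forall p, A p -> forall J, exists2 i, (J <= i)%N & mdist p.1 (tau i) < r i) ->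
  content_null s A.
Proof.
move=> s1 /andP[q0 q1] r01 rC A01 AJ e e0.
have C0 : 0 < C by have := rC 0%N; have := r01 0%N; rewrite expr0 mulr1; lra.
have s0 : 0 < s by lra.
have s10 : 0 < s - 1 by rewrite subr_gt0.
pose p := q `^ (s - 1).
have p0 : 0 < p by rewrite powR_gt0.
have p1 : p < 1.
  have := @gt0_ltr_powR R _ s10 q 1; rewrite powR1 !nnegrE => h.
  by apply: h => //; rewrite ltW.
pose M := 2 * 2 `^ s * C `^ (s - 1).
have M0 : 0 < M by rewrite !mulr_gt0 ?powR_gt0.
have [J pJ] : exists J, M * p ^+ J / (1 - p) <= e.
  have := @cvg_expr R p; rewrite ger0_norm ?(ltW p0)// => /(_ p1).
  move/cvgrPdist_le => /(_ (e * (1 - p) / M)) []; first by rewrite divr_gt0// mulr_gt0// subr_gt0.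
  move=> J _ /(_ J (leqnn J)); rewrite sub0r normrN ger0_norm ?exprn_ge0 ?(ltW p0)//.
  by rewrite ler_pdivlMr// => h; exists J; rewrite ler_pdivrMr ?subr_gt0// mulrC.
apply: (@content_le_sub _ _ _ _ (\bigcup_n
   [set p : torus R D * R^o | mdist p.1 (tau (J + n)%N) < r (J + n)%N /\ 0 <= p.2 <= 1])
  e e) => //.
  move=> x Ax; have [i Ji xi] := AJ x Ax J; exists (i - J)%N => //.
  by rewrite /= subnKC//; split => //; exact: A01.
apply: (content_le_bigcup (fun n => content_ball_strip (tau (J + n)%N) (ltW s0) (r01 (J + n)%N))).
move=> N; apply: le_trans pJ.
apply: (@le_trans _ _ (\sum_(n < N) M * p ^+ J * p ^+ n)).
  apply: ler_sum => n _; rewrite -[leRHS]mulrA -exprD; set i := (J + n)%N.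
  have /andP[ri0 ri1] := r01 i.
  have rs : r i `^ s = r i `^ (s - 1) * r i.
    have := @powRD R (r i) (s - 1) 1; rewrite subrK powRr1 ?(ltW ri0)//.
    by apply; rewrite (gt_eqF ri0) implybT.
  rewrite powRM ?(ltW ri0)// rs [leLHS](_ : _ = 2 * 2 `^ s * r i `^ (s - 1)); last first.
    by field; rewrite gt_eqF.
  rewrite /M -[leRHS]mulrA; apply: ler_wpM2l; first by rewrite mulr_ge0// powR_ge0.
  apply: (@le_trans _ _ ((C * q ^+ i) `^ (s - 1))).
    apply: ge0_ler_powR; rewrite ?nnegrE ?(ltW s10) ?(ltW ri0)//.
    by rewrite mulr_ge0 ?exprn_ge0 ?ltW.
  rewrite powRM ?exprn_ge0 ?(ltW q0) ?(ltW C0)//.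
  by rewrite /p -!powR_mulrn ?powR_ge0 ?(ltW q0)// -!powRrM [i%:R * _]mulrC.
rewrite -mulr_sumr ler_pM2l ?mulr_gt0 ?exprn_gt0 ?powR_gt0//.
by apply: sum_geometric_le; rewrite (ltW p0).
Qed.

(** * Counting the recovery steps *)

(** A set of integers in the window ]l, h] with gaps at least g has at most
    1 + (h - l) / g elements. *)
Lemma separated_count (p : pred nat) (g l h : nat) : (0 < g)%N ->
  (forall i i', l < i -> i < i' -> i' <= h -> p i -> p i' -> i + g <= i')%N ->
  ((\sum_(l.+1 <= i < h.+1) p i) * g <= (h - l) + g)%N.
Proof.
move=> g0; have [k] := ubnP h; elim: k h => // k IH h hk sep.
have [hl|lh] := leqP h l; first by rewrite big_geq.
have [ph|nph] := boolP (p h); last first.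
  case: h hk sep lh nph => // h hk sep lh nph.
  rewrite big_nat_recr//= (negbTE nph) addn0.
  apply: leq_trans (IH h _ _) _; [lia| |lia].
  by move=> i i' li ii' i'h; apply: sep => //; lia.
have zero i : (l < i)%N -> (h - g < i)%N -> (i < h)%N -> p i = false :> bool.
  move=> li gi ih; apply/negP => pi; have := sep i h li ih (leqnn h) pi ph; lia.
have sum0 u : (l < u)%N -> (h - g < u)%N -> (\sum_(u <= i < h) p i = 0)%N.
  move=> lu gu; rewrite big_nat_cond big1// => i /andP[/andP[ui ih] _].
  by rewrite zero//; lia.
rewrite big_nat_recr//= ph.
have [gl|lg] := leqP (h - g) l; first by rewrite sum0 ?add0n ?mul1n ?leq_addl.
rewrite (@big_cat_nat _ _ _ (h - g).+1)/=; [|by lia|by lia].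
rewrite (sum0 (h - g).+1); [|by lia|by lia].
rewrite addn0 mulnDl mul1n leq_add2r.
apply: (leq_trans (IH (h - g)%N _ _)); [lia| |lia].
by move=> i i' li ii' i'h; apply: sep => //; lia.
Qed.

(** A lower bound for the time between two visits of depth greater than t to the
    critical region. *)
Definition visit_gap (m t : nat) : nat := if t is 0 then m else (m.+1 ^ t)%N.

Lemma sum_visit_gap_le (R : realFieldType) (m N : nat) : (0 < m)%N ->
  \sum_(t < N) (visit_gap m t)%:R^-1 <= 2 / m%:R :> R.
Proof.
move=> m0; case: N => [|N]; first by rewrite big_ord0 divr_ge0.
have m0' : 0 < m%:R :> R by rewrite ltr0n.
have := @sum_geometric_le R m.+1%:R^-1 N.+1; rewrite !big_ord_recl/= expr0.
under [X in 1 + X <= _]eq_bigr do rewrite exprVn -natrX.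
rewrite invr_ge0 ler0n invf_lt1 ?ltr0n// ltr1n ltnS m0 => /(_ isT).
rewrite (_ : (1 - _)^-1 = 1 + m%:R^-1); last first.
  by rewrite -natr1; field; apply/andP; split; apply: lt0r_neq0; lra.
have -> : 2 / m%:R = m%:R^-1 + m%:R^-1 :> R by ring.
by rewrite !lerD2l.
Qed.

(** Times are counted backwards, and an orbit starts at time n. Q i is the depth
    of its visit to the critical region at time i (0 if there is none), and P i
    is the number of steps that it then needs to recover: each step lowers P by
    one, and each visit raises it by its depth. Visits of depth greater than t are separated by
    visit_gap m t, and those at time i > j have depth at most i / m. *)
Section Recovery.
Context (R : realFieldType) (m j n : nat) (Q P : nat -> nat).
Hypothesis m3 : (3 <= m)%N.
Hypothesis Q_le : forall i, (j < i <= n)%N -> (Q i <= i %/ m)%N.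
Hypothesis Q_sep : forall t i i', (j < i)%N -> (i < i')%N -> (i' <= n)%N ->
  (t < Q i)%N -> (t < Q i')%N -> (i + visit_gap m t <= i')%N.

Let m0 : (0 < m)%N. Proof. by apply: leq_trans m3. Qed.

Lemma visit_gap_gt0 t : (0 < visit_gap m t)%N.
Proof. by case: t => // t; rewrite expn_gt0. Qed.

(** The total depth of the visits in a window is the sum over t of the numbers
    of visits of depth greater than t. *)
Lemma sum_depth_le l h : (j <= l)%N -> (l <= h <= n)%N ->
  (\sum_(l.+1 <= i < h.+1) Q i)%N%:R <= h%:R / m%:R + 2 * (h - l)%:R / m%:R :> R.
Proof.
move=> jl /andP[lh hn].
have hm : (h %/ m)%N%:R <= h%:R / m%:R :> R.
  by rewrite ler_pdivlMr ?ltr0n// -natrM ler_nat leq_trunc_div.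
have -> : (\sum_(l.+1 <= i < h.+1) Q i =
    \sum_(t < h %/ m) \sum_(l.+1 <= i < h.+1) (t < Q i))%N.
  rewrite exchange_big/= big_nat [RHS]big_nat; apply: eq_bigr => i /andP[li ih].
  rewrite -(big_mkord xpredT (fun t => (t < Q i) : nat)).
  have Qi : (Q i <= h %/ m)%N.
    by rewrite (leq_trans (Q_le _)) ?leq_div2r//; lia.
  by rewrite sum_ltn; apply/esym/minn_idPr.
rewrite natr_sum.
apply: (@le_trans _ _ (\sum_(t < h %/ m) (1 + (h - l)%:R * (visit_gap m t)%:R^-1))).
  apply: ler_sum => t _.
  have g0 : 0 < (visit_gap m t)%:R :> R by rewrite ltr0n visit_gap_gt0.
  rewrite -(ler_pM2r g0) mulrDl mulfVK ?gt_eqF// mul1r -natrM -natrD ler_nat addnC.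
  apply: separated_count; first exact: visit_gap_gt0.
  by move=> i i' li ii' i'h; apply: Q_sep => //; lia.
rewrite big_split/= sumr_const card_ord -mulr_sumr lerD//.
by rewrite -mulrA mulrCA ler_wpM2l// sum_visit_gap_le.
Qed.

Hypothesis P_end : P n = 0%N.
Hypothesis P_rec : forall i, (j <= i < n)%N -> P i = ((P i.+1).-1 + Q i.+1)%N.

(** The window runs back from i to the last time at which the orbit was
    recovered. *)
Lemma recovery_window i : (j <= i <= n)%N -> exists2 h, (i <= h <= n)%N &
  (P i + (h - i) <= 1 + \sum_(i.+1 <= k < h.+1) Q k)%N.
Proof.
move=> /andP[ji ni]; have [k ik] : exists k, (n = i + k)%N by exists (n - i)%N; lia.
elim: k i ik ji ni => [|k IH] i ik ji ni.
  by exists n; [lia|rewrite big_geq; [rewrite (_ : i = n) ?P_end; lia|lia]].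
have [ink|ink] := leqP n i.
  by exists n; [lia|rewrite big_geq; [rewrite (_ : i = n) ?P_end; lia|lia]].
have [h /andP[ih hn]] : exists2 h, (i.+1 <= h <= n)%N &
  (P i.+1 + (h - i.+1) <= 1 + \sum_(i.+2 <= k < h.+1) Q k)%N by apply: IH; lia.
rewrite (P_rec (i := i)) ?ji//.
case Pi: (P i.+1) => [|p] Pih.
  by exists i.+1; [lia|rewrite big_nat1; lia].
by exists h; [lia|rewrite big_ltn; lia].
Qed.

Lemma recovery_le i : (j <= i <= n)%N -> (P i)%:R <= 1 + i%:R / m%:R :> R.
Proof.
move=> jin; have [h /andP[ih hn] Ph] := recovery_window jin.
have /andP[ji _] := jin.
have := @sum_depth_le i h ji; rewrite ih hn => /(_ isT).
move: Ph; rewrite -(ler_nat R) !natrD natrB// => Ph Qh.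
have m0R : 0 < m%:R :> R by rewrite ltr0n.
(* The window itself, of length h - i, outweighs the terms of order 1 / m. *)
have Lm : 3 * (h%:R - i%:R) / m%:R <= h%:R - i%:R :> R.
  rewrite ler_pdivrMr// mulrC ler_wpM2l ?subr_ge0 ?ler_nat//.
move: Lm; rewrite !mulrBr !mulrBl; move: Qh; rewrite mulrBr mulrBl.
lra.
Qed.

(** Only a proportion O(1 / m) of the times up to k is spent recovering. *)
Lemma recovering_count k : (j <= k <= n)%N ->
  (\sum_(j.+1 <= i < k.+1) (0 < P i))%N%:R <= 1 + 4 * k%:R / m%:R :> R.
Proof.
move=> /andP[jk kn].
(* Apart from the depths added, each recovering step lowers P by one. *)
have E : (\sum_(j.+1 <= i < k.+1) (0 < P i) + P j =
    P k + \sum_(j.+1 <= i < k.+1) Q i)%N.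
  elim: k jk kn => [|k IH] jk kn.
    by rewrite !big_geq// (_ : j = 0%N)//; lia.
  have [kj|kj] := leqP k.+1 j.
    by rewrite !big_geq//; rewrite (_ : j = k.+1)//; lia.
  have Pk : P k = ((P k.+1).-1 + Q k.+1)%N by apply: P_rec; lia.
  have jk' : (j <= k)%N by lia.
  rewrite big_nat_recr//= [in RHS]big_nat_recr//=; have := IH jk' (ltnW kn); rewrite Pk.
  by case: (P k.+1) => [|p] /=; lia.
have m0R : 0 < m%:R :> R by rewrite ltr0n.
have := @sum_depth_le j k (leqnn j); rewrite jk kn => /(_ isT).
have := @recovery_le k; rewrite jk kn => /(_ isT).
have : (\sum_(j.+1 <= i < k.+1) (0 < P i) <= P k + \sum_(j.+1 <= i < k.+1) Q i)%N.
  by rewrite -E leq_addr.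
rewrite -(ler_nat R) natrD.
have : 2 * (k - j)%:R / m%:R <= 2 * k%:R / m%:R :> R.
  by rewrite ler_wpM2r ?invr_ge0// ler_wpM2l// ler_nat leq_subr.
have := ler0n R j.
rewrite -!mulrA; lra.
Qed.

End Recovery.

(** * Backward orbits and iterated upper bounding lines *)

(** Iterating an estimate e_i <= L_i e_(i+1) + u. *)
Lemma iterated_error_le (R : realFieldType) (e L : nat -> R) (u : R) (n : nat) :
  (forall i, (i < n)%N -> 0 <= L i) ->
  (forall i, (i < n)%N -> e i <= L i * e i.+1 + u) ->
  e 0%N <= (\prod_(i < n) L i) * e n + u * \sum_(k < n) \prod_(i < k) L i.
Proof.
elim: n => [|n IH] L0 eL; first by rewrite !big_ord0 mul1r mulr0 addr0.
apply: le_trans (IH _ _) _; [by move=> i ?; apply: L0; lia|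
                             by move=> i ?; apply: eL; lia|].
rewrite big_ord_recr [in leRHS]big_ord_recr/= [in leRHS]mulrDr.
have p0 : 0 <= \prod_(i < n) L i by apply: prodr_ge0 => i _; apply: L0; have := ltn_ord i; lia.
have := ler_wpM2l p0 (eL n (ltnSn n)); lra.
Qed.

(** A product of factors alpha^(- gamma), except for a small proportion of
    factors alpha, decays exponentially: (1 + gamma) * kappa < gamma makes the
    rate on the right less than 1. *)
Lemma prod_rate_le (R : realType) (alpha gamma C kappa : R) (bad : pred nat)
    (k : nat) : 1 < alpha -> 0 < gamma ->
  (\sum_(i < k) bad i)%N%:R <= C + kappa * k%:R ->
  \prod_(i < k) (if bad i then alpha else alpha `^ (- gamma)) <=
  alpha `^ ((1 + gamma) * C) * (alpha `^ (- (gamma - (1 + gamma) * kappa))) ^+ k.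
Proof.
move=> a1 g0 badC; have a0 : 0 < alpha by lra.
have aD x y : alpha `^ (x + y) = alpha `^ x * alpha `^ y.
  by rewrite powRD// (gt_eqF a0) implybT.
have -> : \prod_(i < k) (if bad i then alpha else alpha `^ (- gamma)) =
    alpha `^ ((1 + gamma) * (\sum_(i < k) bad i)%N%:R - gamma * k%:R).
  elim: k {badC} => [|k IH]; first by rewrite !big_ord0 !mulr0 subr0 powRr0.
  rewrite !big_ord_recr/= {}IH natrD -natr1.
  case: ifPn => _; [rewrite -[X in _ * X](powRr1 (ltW a0))|]; rewrite -aD/=;
    by congr (_ `^ _); ring.
rewrite -powR_mulrn ?powR_ge0// -powRrM -aD.
apply: ler_powR; first exact: ltW.
have : (1 + gamma) * (\sum_(i < k) bad i)%N%:R <= (1 + gamma) * (C + kappa * k%:R).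
  by rewrite ler_wpM2l//; lra.
lra.
Qed.

Section IteratedBounds.
Context (R : realType) (D : nat).
Local Notation torus := (torus R D).
Implicit Types (rho : 'rV[R]_D) (f : torus -> R -> R) (theta : torus).

Lemma torus_distD (x y z : torus) :
  torus_dist (x + z) (y + z) = torus_dist x y.
Proof.
suff le (x' y' z' : torus) : torus_dist (x' + z') (y' + z') <= torus_dist x' y'.
  apply/eqP; rewrite eq_le le/=.
  by rewrite -[X in torus_dist X _](addrK z) -[X in torus_dist _ X](addrK z) le.
apply: lb_le_inf; first exact: (has_inf_dist_set _ _).1.
move=> _ [u [v [<- <- ->]]]; rewrite -[z']reprK -!raddfD.
apply: le_trans (torus_dist_le _ _) _.
by rewrite opprD addrACA subrr addr0.
Qed.

(** The point theta - i rho, whose i-th rotate is theta. *)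
Definition back rho theta (i : nat) : torus := theta - (\pi_torus rho) *+ i.

Lemma back0 rho theta : back rho theta 0 = theta.
Proof. by rewrite /back mulr0n subr0. Qed.

Lemma iter_rotation rho theta n :
  iter n (rotation rho) theta = theta + (\pi_torus rho) *+ n.
Proof.
elim: n => [|n IH] /=; first by rewrite mulr0n addr0.
by rewrite IH /rotation mulrSr addrA.
Qed.

Lemma torus_dist_back rho theta theta' i :
  torus_dist (back rho theta i) (back rho theta' i) = torus_dist theta theta'.
Proof. exact: torus_distD. Qed.

(** The iterated upper bounding lines: phi_n(theta) is the image of 1 under the
    n-th iterate over theta - n rho. *)
Fixpoint upper_line rho f (n : nat) theta : R :=
  if n is n'.+1 then f (back rho theta 1) (upper_line rho f n' (back rho theta 1))
  else 1.

(** The orbit of 1 started over theta - n rho, when it is i steps short of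
    theta. *)
Definition upper_orbit rho f n theta i : R :=
  upper_line rho f (n - i) (back rho theta i).

Lemma upper_orbitE rho f n theta i : (i < n)%N ->
  upper_orbit rho f n theta i =
  f (back rho theta i.+1) (upper_orbit rho f n theta i.+1).
Proof.
move=> ni; rewrite /upper_orbit (_ : n - i = (n - i.+1).+1)%N; last by lia.
rewrite /= (_ : back rho (back rho theta i) 1 = back rho theta i.+1)//.
by rewrite /back mulr1n mulrSr opprD addrA.
Qed.

Lemma upper_line01 rho f n theta :
  (forall theta, set_fun `[0, 1] `[0, 1] (f theta)) ->
  upper_line rho f n theta \in `[0, 1].
Proof.
move=> f01; elim: n theta => [|n IH] theta /=; first by rewrite in_itv/= ler01 lexx.
exact: (f01 _ _ (IH _)).
Qed.

(** The depth of the visit of theta - i rho to the critical region, the ball of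
    radius b / 2 about theta_star: the least power of a which makes up for the
    factor lost there. The search stops at i %/ m, which is the value when no
    smaller power suffices. *)
Definition depth (a b : R) (m : nat) (theta_star : torus) rho theta (i : nat) : nat :=
  find (fun t => 1 <= a ^+ t * (2 / b * mdist (back rho theta i) theta_star))
       (iota 0 (i %/ m)).

(** The base points whose backward orbit does not come exponentially close to
    the critical point after time j. *)
Definition slow_set (a b : R) (m : nat) (theta_star : torus) rho (j : nat) : set torus :=
  [set theta | forall i, (j < i)%N ->
     b / 2 * a ^- (i %/ m) <= mdist (back rho theta i) theta_star].

(** A bound for the number of steps that the orbit of 1 started n steps short of
    theta needs, i steps short of theta, to exceed L0 again, computed from the
    depths Q of the visits in between. *)
Definition recovery_time (Q : nat -> nat) (n i : nat) : nat :=
  (fix p k := if k is k'.+1 then (p k').-1 + Q (n - k') else 0)%N (n - i)%N.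

Lemma recovery_time_end Q n : recovery_time Q n n = 0%N.
Proof. by rewrite /recovery_time subnn. Qed.

Lemma recovery_timeE Q n i : (i < n)%N ->
  recovery_time Q n i = ((recovery_time Q n i.+1).-1 + Q i.+1)%N.
Proof.
move=> ni; rewrite {1}/recovery_time (_ : n - i = (n - i.+1).+1)%N; last by lia.
by rewrite -/(recovery_time Q n i.+1) (_ : n - (n - i.+1) = i.+1)%N//; lia.
Qed.

End IteratedBounds.

(** * Uniform Lipschitz bounds on slow sets *)

Section UniformLipschitz.
Context (R : realType) (D : nat) (rho : 'rV[R]_D) (f : torus R D -> R -> R)
  (theta_star : torus R D) (alpha gamma L0 beta c d : R) (m : nat) (a b : R).
Hypothesis fibre : forall theta, set_fun `[0, 1] `[0, 1] (f theta).
Hypothesis H : Tstar_conditions rho f theta_star alpha gamma L0 beta c d m a b.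
Local Notation dep := (depth a b m theta_star rho).
Local Notation slow := (slow_set a b m theta_star rho).

Let a0 : 0 < a. Proof. by have := Tstar_a H; lra. Qed.
Let b0 : 0 < b. Proof. by have /andP[] := Tstar_b H. Qed.
Let g0 : 0 < gamma. Proof. exact: Tstar_gamma H. Qed.
Let m0 : (0 < m)%N. Proof. exact: Tstar_m H. Qed.
Let m0R : 0 < m%:R :> R. Proof. by rewrite ltr0n m0. Qed.

Lemma m_gamma : 22 * (1 + gamma) < gamma * m%:R.
Proof.
have := Tstar_m_large H; rewrite -(ltr_pM2l g0).
by rewrite (_ : gamma * (22 * _) = 22 * (1 + gamma))//; field; rewrite gt_eqF.
Qed.

Lemma m_ge3 : (3 <= m)%N.
Proof.
rewrite ltnNge; apply/negP => m2; have := m_gamma.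
have m2R : m%:R <= 2 :> R by rewrite (ler_nat R m 2).
have := ler_wpM2l (ltW g0) m2R; have := g0; lra.
Qed.

Lemma depth_le theta i : (dep theta i <= i %/ m)%N.
Proof. by rewrite /depth (leq_trans (find_size _ _))// size_iota. Qed.

(** At a slow base point, the depth does make up for the factor lost. *)
Lemma depth_recover theta j i : slow j theta -> (j < i)%N ->
  1 <= a ^+ dep theta i * (2 / b * mdist (back rho theta i) theta_star).
Proof.
move=> sl ji; rewrite {1}/depth; set p := (fun t : nat => _).
have [hp|nhp] := boolP (has p (iota 0 (i %/ m))).
  have := nth_find 0%N hp; rewrite nth_iota ?add0n//.
  by rewrite -[X in (_ < X)%N](size_iota 0 (i %/ m)) -has_find.
rewrite hasNfind// size_iota; have := sl i ji.
rewrite mulrA -ler_pdivrMl; last by rewrite mulr_gt0 ?exprn_gt0 ?divr_gt0.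
by rewrite mulr1 invfM invf_div mulrC.
Qed.

Lemma depth_lt theta i t : (t < dep theta i)%N ->
  mdist (back rho theta i) theta_star < b / 2 * a ^- t.
Proof.
move=> ti; have tim := leq_trans ti (depth_le theta i).
have := before_find 0%N ti; rewrite nth_iota// add0n => /negbT; rewrite -ltNge.
rewrite mulrA -ltr_pdivlMl; last by rewrite mulr_gt0 ?exprn_gt0 ?divr_gt0.
by rewrite mulr1 invfM invf_div mulrC.
Qed.

(** Two deep visits are far apart in time, as the critical orbit does not
    return closely to its starting point too soon. *)
Lemma depth_gap theta t i i' : (i < i')%N ->
  (t < dep theta i)%N -> (t < dep theta i')%N -> (i + visit_gap m t <= i')%N.
Proof.
move=> ii' /depth_lt ti /depth_lt ti'.
set p := (i' - i)%N; have p0 : (0 < p)%N by rewrite subn_gt0.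
suff : (visit_gap m t <= p)%N by rewrite /p; lia.
have ret : mdist (iter p (rotation rho) theta_star) theta_star < b * a ^- t.
  have -> : b * a ^- t = b / 2 * a ^- t + b / 2 * a ^- t by field; rewrite expf_neq0 ?gt_eqF.
  apply: le_lt_trans (torus_dist_triangle (back rho theta i) _ _) _.
  apply: ltrD => //; rewrite torus_dist_sym.
  rewrite (_ : back rho theta i = iter p (rotation rho) (back rho theta i')).
    by rewrite !iter_rotation torus_distD.
  rewrite iter_rotation /back -addrA; congr (_ + _).
  by rewrite -[in RHS](subnK (ltnW ii')) -/p mulrnDr opprD addrAC addNr add0r.
case: t ti ti' ret => [|t] ti ti' ret /=.
  rewrite leqNgt; apply/negP => pm.
  have /(Tstar_no_return H) : (1 <= p <= m.-1)%N by lia.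
  by move: ret; rewrite expr0 invr1 mulr1 => ret /(lt_trans ret); rewrite ltxx.
rewrite -(ler_nat R) natrX leNgt; apply/negP => pt.
have d0 : 0 < d by have := Tstar_d H; lra.
have pd : p%:R `^ d < a ^+ t.+1.
  apply: (@lt_le_trans _ _ ((m.+1%:R ^+ t.+1) `^ d)).
    by apply: gt0_ltr_powR; rewrite ?nnegrE ?exprn_ge0.
  rewrite -powR_mulrn// -powRrM mulrC powRrM powR_mulrn ?powR_ge0//.
  by rewrite lerXn2r ?nnegrE ?powR_ge0 ?(ltW a0)// (Tstar_a_large H).
have p0R : 0 < p%:R `^ d by rewrite powR_gt0// ltr0n.
have := le_lt_trans (Tstar_diophantine H p0) ret.
rewrite powRN ltNge => /negP; apply; apply: ler_pM.
- exact: ltW.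
- by rewrite invr_ge0 exprn_ge0// ltW.
- exact: Tstar_b_small H.
- by rewrite lef_pV2 ?posrE ?exprn_gt0// ltW.
Qed.

(** Outside the critical region a point x is mapped to at least min(L0, a x);
    inside it, a power of a given by the depth is lost. *)
Lemma recovery_bound j n theta i : slow j theta -> (j <= i <= n)%N ->
  L0 <= a ^+ recovery_time (dep theta) n i * upper_orbit rho f n theta i.
Proof.
move=> sl /andP[ji ni]; have [k ik] : exists k, (n = i + k)%N by exists (n - i)%N; lia.
have /andP[L00 L01] := Tstar_L0 H.
elim: k i ik ji ni => [|k IH] i ik ji ni.
  rewrite (_ : i = n); last by lia.
  by rewrite recovery_time_end expr0 mul1r /upper_orbit subnn /= ltW.
have lt_in : (i < n)%N by lia.
have {}IH := IH i.+1 ltac:(lia) ltac:(lia) lt_in.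
rewrite recovery_timeE// upper_orbitE//.
set x := upper_orbit rho f n theta i.+1; set Q := dep theta i.+1.
set P := recovery_time _ n i.+1; rewrite -/x -/P in IH.
have x01 : x \in `[0, 1] by exact: upper_line01.
have rec := depth_recover sl (ji : (j < i.+1)%N); rewrite -/Q in rec.
have low := Tstar_lower H (back rho theta i.+1) x01.
set u := Num.min L0 (a * x) in low; set v := Num.min 1 _ in low.
have Pu : L0 <= a ^+ P.-1 * u.
  rewrite /u minr_pMr; last by rewrite exprn_ge0 ?ltW.
  rewrite le_min; apply/andP; split.
    by rewrite ler_peMl ?(ltW L00)// exprn_ege1// ltW// (Tstar_a H).
  rewrite mulrA -exprSr; apply: le_trans IH _.
  have x0 : 0 <= x by move: x01; rewrite in_itv/= => /andP[].
  rewrite ler_wpM2r//; case: (P) => //=; rewrite expr0 expr1.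
  exact: ltW (Tstar_a H).
have Qv : 1 <= a ^+ Q * v.
  rewrite /v minr_pMr; last by rewrite exprn_ge0 ?ltW.
  by rewrite le_min rec mulr1 exprn_ege1// ltW// (Tstar_a H).
rewrite exprD; apply: (@le_trans _ _ (a ^+ P.-1 * a ^+ Q * (u * v))); last first.
  by rewrite ler_wpM2l// mulr_ge0// exprn_ge0 ?ltW.
rewrite mulrACA -[leLHS]mulr1; apply: ler_pM => //.
by rewrite ltW.
Qed.

Lemma recovered_orbit j n theta i : slow j theta -> (j <= i <= n)%N ->
  recovery_time (dep theta) n i = 0%N ->
  upper_orbit rho f n theta i \in `[L0, 1].
Proof.
move=> sl jin P0; have := recovery_bound sl jin; rewrite P0 expr0 mul1r.
have := upper_line01 rho (n - i) (back rho theta i) fibre.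
by rewrite /upper_orbit !in_itv/= => /andP[_ ->] ->.
Qed.

Lemma recovering_proportion j n theta k : (j <= k <= n)%N ->
  (\sum_(j.+1 <= i < k.+1) (0 < recovery_time (dep theta) n i))%N%:R
    <= 1 + 4 * k%:R / m%:R :> R.
Proof.
apply: (@recovering_count R m j n (dep theta)).
- exact: m_ge3.
- by move=> i _; exact: depth_le.
- by move=> t i i' _ ii' _ ti ti'; exact: (depth_gap ii' ti ti').
- exact: recovery_time_end.
- by move=> i /andP[_ ni]; exact: recovery_timeE.
Qed.

(** The steps, counted backwards, in which one of the orbits of 1 towards theta
    and theta' may be expanded. *)
Definition expanding j n theta theta' : pred nat := fun i =>
  [|| (i < j)%N, (0 < recovery_time (dep theta) n i.+1)%N |
      (0 < recovery_time (dep theta') n i.+1)%N].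

Lemma expanding_count j n theta theta' k : (k <= n)%N ->
  (\sum_(i < k) expanding j n theta theta' i)%N%:R
    <= (j%:R + 2) + 8 / m%:R * k%:R :> R.
Proof.
move=> kn; rewrite -(big_mkord xpredT (fun i => expanding j n theta theta' i : nat)).
have count1 h : (\sum_(0 <= i < h) expanding j n theta theta' i <= h)%N.
  rewrite -[leqRHS]muln1 -[X in (_ <= X * _)%N]subn0 -sum_nat_const_nat.
  by apply: leq_sum => i _; case: expanding.
have km0 : 0 <= 8 / m%:R * k%:R :> R by rewrite mulr_ge0// divr_ge0// ltW.
have [kj|jk] := leqP k j.
  apply: (@le_trans _ _ k%:R); first by rewrite ler_nat.
  by have : k%:R <= j%:R :> R by [rewrite ler_nat]; lra.
rewrite (@big_cat_nat _ _ _ j)//=; last exact: ltnW.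
have Hj : (\sum_(j <= i < k) expanding j n theta theta' i <=
  \sum_(j.+1 <= i < k.+1) (0 < recovery_time (dep theta) n i) +
  \sum_(j.+1 <= i < k.+1) (0 < recovery_time (dep theta') n i))%N.
  rewrite -big_split big_add1/= big_nat [leqRHS]big_nat.
  apply: leq_sum => i /andP[ji _]; rewrite /expanding ltnNge ji/=.
  by case: (0 < _)%N; case: (0 < _)%N.
have jkn : (j <= k <= n)%N by rewrite (ltnW jk).
have := recovering_proportion theta jkn; have := recovering_proportion theta' jkn.
move: (leq_add (count1 j) Hj); rewrite -(ler_nat R) !natrD.
rewrite (_ : 8 / m%:R * k%:R = 4 * k%:R / m%:R + 4 * k%:R / m%:R); last by ring.
lra.
Qed.

Lemma upper_orbit_step j n theta theta' i : slow j theta -> slow j theta' ->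
  (i < n)%N ->
  `|upper_orbit rho f n theta i - upper_orbit rho f n theta' i| <=
  (if expanding j n theta theta' i then alpha else alpha `^ (- gamma)) *
   `|upper_orbit rho f n theta i.+1 - upper_orbit rho f n theta' i.+1|
  + beta * mdist theta theta'.
Proof.
move=> sl sl' ni.
rewrite (upper_orbitE rho f theta ni) (upper_orbitE rho f theta' ni).
have x01 := upper_line01 rho (n - i.+1) (back rho theta i.+1) fibre.
have x'01 := upper_line01 rho (n - i.+1) (back rho theta' i.+1) fibre.
rewrite -/(upper_orbit _ _ _ _ _) in x01; rewrite -/(upper_orbit _ _ _ _ _) in x'01.
set x := upper_orbit _ _ _ _ _; set x' := upper_orbit _ _ _ _ _.
set t := back rho theta i.+1; set t' := back rho theta' i.+1.
rewrite (_ : f t x - f t' x' = (f t x - f t x') + (f t x' - f t' x')); last by ring.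
apply: le_trans (ler_normD _ _) _; apply: lerD; last first.
  apply: le_trans (Tstar_lipschitz H t t' x'01) _.
  by rewrite /mdist/= torus_dist_back.
case: ifPn => [_|]; first exact: (Tstar_expansion H t x01 x'01).
rewrite /expanding !negb_or -!leqNgt !leqn0 => /and3P[ji /eqP P0 /eqP P'0].
apply: (Tstar_contraction H t).
  by apply: recovered_orbit sl _ P0; rewrite (leq_trans ji).
by apply: recovered_orbit sl' _ P'0; rewrite (leq_trans ji).
Qed.

(** The iterated upper bounding lines are Lipschitz on slow sets, uniformly in
    n. *)
Lemma upper_line_lipschitz j : exists2 K : R, 0 <= K &
  forall n theta theta', slow j theta -> slow j theta' ->
  `|upper_line rho f n theta - upper_line rho f n theta'| <=
  K * mdist theta theta'.
Proof.
have al := Tstar_alpha H; have be := Tstar_beta H.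
(* Each of the two orbits is recovering for a proportion of about 4 / m of
   the time. *)
pose eta := gamma - (1 + gamma) * (8 / m%:R).
have eta0 : 0 < eta.
  rewrite subr_gt0 mulrA ltr_pdivrMr//; have := m_gamma; have := g0; lra.
pose lam := alpha `^ (- eta).
have lam01 : 0 <= lam < 1.
  rewrite powR_ge0/= /lam powRN invf_lt1 ?powR_gt0//; last by lra.
  have := @gt0_ltr_powR R _ eta0 1 alpha; rewrite powR1 !nnegrE; apply; lra.
pose M := alpha `^ ((1 + gamma) * (j%:R + 2)).
have M0 : 0 <= M by exact: powR_ge0.
have K0 : 0 <= beta * (M * (1 - lam)^-1).
  case/andP: lam01 => _ /ltW lam1.
  by rewrite mulr_ge0 ?(ltW be)// mulr_ge0// invr_ge0 subr_ge0.
exists (beta * (M * (1 - lam)^-1)) => // n theta theta' sl sl'.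
pose L i := if expanding j n theta theta' i then alpha else alpha `^ (- gamma).
have L_ge0 i : 0 <= L i by rewrite /L; case: ifP => _; [lra|exact: powR_ge0].
have := @iterated_error_le R
  (fun i => `|upper_orbit rho f n theta i - upper_orbit rho f n theta' i|) L
  (beta * mdist theta theta') n (fun i _ => L_ge0 i)
  (fun i ni => upper_orbit_step sl sl' ni).
rewrite /upper_orbit subn0 subnn !back0 /= subrr normr0 mulr0 add0r.
move/le_trans; apply; rewrite [leRHS]mulrAC.
apply: ler_wpM2l; first by rewrite mulr_ge0 ?mdist_ge0// ltW.
apply: (@le_trans _ _ (\sum_(k < n) M * lam ^+ k)).
  apply: ler_sum => k _; apply: prod_rate_le => //; first by lra.
  by apply: expanding_count; exact: ltnW.
by rewrite -mulr_sumr ler_wpM2l// sum_geometric_le.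
Qed.

End UniformLipschitz.

(** * The upper bounding function *)

Lemma lipschitz_within_continuous (R : realType) (g : R -> R) (K u v : R) :
  {in `[u, v] &, forall x y, `|g x - g y| <= K * `|x - y|} ->
  {within `[u, v], continuous g}.
Proof.
move=> gK; apply/subspace_continuousP => x xuv.
apply/cvgrPdist_lt => e e0; rewrite near_withinE; near=> y => yuv.
apply: (@le_lt_trans _ _ ((`|K| + 1) * `|x - y|)).
  apply: le_trans (gK x y _ _) _; rewrite ?inE//.
  by rewrite ler_wpM2r//; have := ler_norm K; lra.
rewrite -ltr_pdivlMl; last by have := normr_ge0 K; lra.
near: y; apply: cvgr_dist_lt => //.
by rewrite mulr_gt0// invr_gt0; have := normr_ge0 K; lra.
Unshelve. all: by end_near. Qed.

Section Attractor.
Context (R : realType) (D : nat) (rho : 'rV[R]_D) (f : torus R D -> R -> R)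
  (alpha : R).
Hypothesis fibre : forall theta, set_fun `[0, 1] `[0, 1] (f theta).
Hypothesis mono : forall theta, {in `[0, 1] &, {homo f theta : x y / x <= y}}.
Hypothesis zero : forall theta, f theta 0 = 0.
Hypothesis lip : forall theta, {in `[0, 1] &, forall x y,
    `|f theta x - f theta y| <= alpha * `|x - y|}.
Local Notation T := (skew_product rho f).
Local Notation phi_plus := (upper_bounding_function T).

Lemma rotationK theta : rotation rho (back rho theta 1) = theta.
Proof. by rewrite /rotation /back mulr1n subrK. Qed.

Lemma backK theta : back rho (rotation rho theta) 1 = theta.
Proof. by rewrite /rotation /back mulr1n addrK. Qed.

(** The fibres of T^n(T^D x [0, 1]) are the segments below the n-th iterated
    upper bounding line. *)
Lemma iter_phase_space n theta (x : R^o) :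
  (iter n T @` @phase_space R D) (theta, x) <->
  0 <= x <= upper_line rho f n theta.
Proof.
elim: n theta x => [|n IH] theta x.
  split; first by case=> -[t y] [_ /=]; rewrite in_itv => y01 [_ <-].
  by move=> x01; exists (theta, x) => //; split => //=; rewrite in_itv.
have line01 := upper_line01 rho n (back rho theta 1) fibre.
have line0 : 0 <= upper_line rho f n (back rho theta 1).
  by move: line01; rewrite in_itv/= => /andP[].
have in01 y : 0 <= y <= upper_line rho f n (back rho theta 1) -> y \in `[0, 1].
  move: line01; rewrite !in_itv/= => /andP[_ l1] /andP[-> yl] /=.
  exact: le_trans l1.
split.
- case=> p pS /= pE; have := imageP (iter n T) pS; move: pE.
  case: (iter n T p) => t y [tE <-] /IH yl.
  rewrite -tE backK in line01 line0 in01 *.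
  have /andP[y0 yle] := yl; rewrite -[X in X <= _ <= _](zero t).
  by rewrite !mono//; apply: in01; rewrite ?lexx ?line0.
- move=> /= x0l; have [|||y] := @segment_continuous_le_surjective R 0
    (upper_line rho f n (back rho theta 1)) (f (back rho theta 1)) line0 _ _ x.
  + by apply: mono => //; apply: in01; rewrite lexx.
  + apply: continuous_subspaceW (lipschitz_within_continuous (@lip _)).
    by move=> y; rewrite /= in_itv => /in01.
  + by rewrite /= in_itv/= zero.
  rewrite /= in_itv/= => yl <-; have /IH[p pS pE] := yl.
  by exists p => //=; rewrite pE /skew_product/= rotationK.
Qed.

Lemma attractor_fibreE theta : [set x : R | x \in `[0, 1] /\
    global_attractor T (theta, x)] =
  [set x | 0 <= x <= 1 /\ forall n, (0 < n)%N -> x <= upper_line rho f n theta].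
Proof.
apply/seteqP; split => x /=; rewrite in_itv/= => -[x01 xA]; split => //.
  by move=> n n0; have /(iter_phase_space n theta x)/andP[] := xA n n0.
move=> n n0; apply/(iter_phase_space n theta x); rewrite xA//.
by case/andP: x01 => ->.
Qed.

Lemma has_sup_attractor_fibre theta : has_sup [set x : R | x \in `[0, 1] /\
    global_attractor T (theta, x)].
Proof.
rewrite attractor_fibreE; split.
  exists 0; split => [|n _]; first by rewrite lexx ler01.
  by have := upper_line01 rho n theta fibre; rewrite in_itv/= => /andP[].
by exists 1 => x [/andP[]].
Qed.

Lemma upper_bounding_function01 theta : 0 <= phi_plus theta <= 1.
Proof.
have [ne ub] := has_sup_attractor_fibre theta; apply/andP; split.
  apply: ub_le_sup => //; rewrite attractor_fibreE.
  split => [|n _]; first by rewrite lexx ler01.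
  by have := upper_line01 rho n theta fibre; rewrite in_itv/= => /andP[].
by apply: ge_sup => // x [+ _]; rewrite in_itv/= => /andP[].
Qed.

(** A uniform Lipschitz bound for the iterated upper bounding lines passes to
    the upper bounding function. *)
Lemma upper_bounding_function_lipschitz (S : set (torus R D)) (K : R) : 0 <= K ->
  (forall n theta theta', S theta -> S theta' ->
    `|upper_line rho f n theta - upper_line rho f n theta'| <= K * mdist theta theta') ->
  forall theta theta', S theta -> S theta' ->
    `|phi_plus theta - phi_plus theta'| <= K * mdist theta theta'.
Proof.
move=> K0 SK.
have half theta theta' : S theta -> S theta' ->
    phi_plus theta <= phi_plus theta' + K * mdist theta theta'.
  move=> St St'; have [ne _] := has_sup_attractor_fibre theta.
  apply: ge_sup => // x; rewrite attractor_fibreE => -[/andP[x0 x1] xl].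
  (* The fibre of the attractor over theta' contains every point of [0, 1]
     below all the lines. *)
  rewrite -lerBlDr; apply: (@le_trans _ _ (Num.max 0 (x - K * mdist theta theta'))).
    by rewrite le_max lexx orbT.
  apply: ub_le_sup; first exact: (has_sup_attractor_fibre _).2.
  rewrite attractor_fibreE; split.
    rewrite le_max lexx/= ge_max ler01/= lerBlDr (le_trans x1)// lerDl.
    by rewrite mulr_ge0// mdist_ge0.
  move=> n n0; rewrite ge_max; apply/andP; split.
    by have := upper_line01 rho n theta' fibre; rewrite in_itv/= => /andP[].
  have := xl n n0; have := ler_norm (upper_line rho f n theta - upper_line rho f n theta').
  have := SK n _ _ St St'; lra.
move=> theta theta' St St'; have := half _ _ St St'; have := half _ _ St' St.
rewrite {1}/mdist/= torus_dist_sym ler_norml /mdist/=; lra.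
Qed.

End Attractor.

(** The base points that are not slow for any delay lie in the limit superior of
    exponentially small balls. *)
Lemma not_slow (R : realType) (D : nat) (rho : 'rV[R]_D) (a b : R) (m : nat)
    (theta_star theta : torus R D) :
  (forall j, ~ slow_set a b m theta_star rho j theta) ->
  forall J, exists2 i, (J <= i)%N &
    mdist theta (theta_star + (\pi_(torus R D) rho) *+ i) < b / 2 * a ^- (i %/ m).
Proof.
move=> nslow J; have := nslow J; rewrite /slow_set /= => /existsNP[i /not_implyP[Ji]].
move=> /negP; rewrite -ltNge => di; exists i; first exact: ltnW.
rewrite (_ : mdist theta _ = mdist (back rho theta i) theta_star)//.
by rewrite /mdist/= -(torus_distD theta _ (- (\pi_(torus R D) rho *+ i))) addrK.
Qed.

(** The radii a^-(i %/ m) decay exponentially in i. *)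
Lemma inv_exp_divn_le (R : realType) (a : R) (m i : nat) : 1 < a -> (0 < m)%N ->
  a ^- (i %/ m) <= a * (a `^ (- m%:R^-1)) ^+ i.
Proof.
move=> a1 m0; have a0 : 0 < a by lra.
rewrite -(powR_mulrn i (powR_ge0 _ _)) -powRrM.
rewrite -[X in _ <= X * _](powRr1 (ltW a0)) -powRD; last first.
  by rewrite (gt_eqF a0) implybT.
rewrite -powR_mulrn ?(ltW a0)// -powRN; apply: ler_powR; first exact: ltW.
have m0R : 0 < m%:R :> R by rewrite ltr0n.
suff : i%:R / m%:R <= (i %/ m)%N.+1%:R :> R.
  by rewrite -[in leRHS]natr1 mulNr [_^-1 * _]mulrC; lra.
by rewrite ler_pdivrMr// -natrM ler_nat ltnW// ltn_ceil.
Qed.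

(** * The dimension of the upper bounding graph *)

(** The graph splits into Lipschitz pieces over the slow sets, and a part over
    the base points that are in no slow set. *)
Lemma upper_bounding_graph_null (R : realType) (D : nat) (rho : 'rV[R]_D)
    (f : torus R D -> R -> R) (s : R) : (0 < D)%N -> class_Tstar rho f ->
  D%:R < s -> content_null s (upper_bounding_graph (skew_product rho f)).
Proof.
pose phi_plus := upper_bounding_function (skew_product rho f).
move=> hD [TT [theta_star _ [alpha [gamma [L0 [beta [c [d [m [a [b H]]]]]]]]]]] Ds.
have fibre := class_T_fibre TT; have mono := class_T_monotone TT.
have zero := class_T_zero TT; have lip := Tstar_expansion H.
have a1 := Tstar_a H; have m0 := Tstar_m H; have /andP[b0 b1] := Tstar_b H.
have s1 : 1 < s by apply: le_lt_trans Ds; rewrite (ler_nat R 1 D).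
pose slow := slow_set a b m theta_star rho.
pose fast : set (torus R D * R^o) :=
  [set p | p.2 = phi_plus p.1 /\ forall j, ~ slow j p.1].
pose piece j := if j is j'.+1 then [set (theta, phi_plus theta : R^o) | theta in slow j']
                else fast.
suff pieces j : content_null s (piece j).
  move=> e e0; apply: content_le_sub (content_null_bigcup pieces e0) => //.
  move=> _ [theta _ <-]; have [[j sl]|ns] := pselect (exists j, slow j theta).
    by exists j.+1 => //; exists theta.
  exists 0%N => //; split => //= j sl; by apply: ns; exists j.
case: j => [|j] /=.
- pose q : R := a `^ (- m%:R^-1).
  have m0R : 0 < m%:R :> R by rewrite ltr0n.
  apply: (@content_null_limsup_balls R D
    (fun i => theta_star + (\pi_(torus R D) rho) *+ i)
    (fun i => b / 2 * a ^- (i %/ m)) (b / 2 * a) q s) => //.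
  + rewrite powR_gt0/=; last by lra.
    rewrite /q powRN invf_lt1 ?powR_gt0//; last by lra.
    have im0 : 0 < m%:R^-1 :> R by rewrite invr_gt0.
    by have := @gt0_ltr_powR R _ im0 1 a; rewrite powR1 !nnegrE; apply; lra.
  + move=> i; have ai0 : 0 < a ^- (i %/ m) by rewrite invr_gt0 exprn_gt0//; lra.
    have ai1 : a ^- (i %/ m) <= 1.
      by rewrite invf_le1 ?exprn_gt0 ?exprn_ege1//; lra.
    apply/andP; split; first by rewrite mulr_gt0// divr_gt0.
    by rewrite mulr_ile1//; lra.
  + move=> i; rewrite -[leRHS]mulrA ler_pM2l ?divr_gt0//.
    exact: inv_exp_divn_le.
  + by move=> p [-> _]; exact: (upper_bounding_function01 rho fibre mono zero lip).
  + by move=> p [_ ns]; exact: not_slow.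
- have [K K0 SK] := upper_line_lipschitz fibre H j.
  apply: (@content_null_lipschitz_graph R D phi_plus (slow j) K s Ds).
  exact: (@upper_bounding_function_lipschitz R D rho f alpha fibre mono zero lip _ K K0 SK).
Qed.

Theorem theorem5p2 (R : realType) (D : nat) (hD : (0 < D)%N)
    (rho : 'rV[R]_D) (f : torus R D -> R -> R) (hT : class_Tstar rho f) :
  hausdorff_dim (upper_bounding_graph (skew_product rho f)) = (D%:R)%:E.
Proof.
apply/eqP; rewrite eq_le; apply/andP; split; last exact: graph_hausdorff_dim_ge.
rewrite ge_max lee_fin ler0n/=; apply: ge_ereal_sup => _ [s [s0 sinf] <-].
rewrite lee_fin leNgt; apply/negP => Ds.
have sgt0 : 0 < s by exact: le_lt_trans Ds.
have := content_null_hausdorff sgt0 (upper_bounding_graph_null hD hT Ds).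
by rewrite sinf ltxx.
Qed.
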